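(* For every odd prime $k\ge 5$ there exists a prime $p$ with $p\equiv \pm 1 \pmod{2k}$ and $p\equiv \pm1 \pmod{12}$ such that $\mathrm{PSL}(2,p)$ is the automorphism group of a non-orientable regular map of valency $k$ which is both self-dual and self-Petrie-dual.
   Context: A regular map is identified with a quadruple $M=(G;x,y,z)$ where $G$ is a finite group generated by three involutions $x,y,z$ such that $x$ and $y$ commute; $G\cong\mathrm{Aut}(M)$. If $yz$ has order $k$ and $zx$ has order $\ell$ (with $k,\ell\ge3$), $(k,\ell)$ is the type and $k$ is the valency of $M$. The map is non-orientable if and only if the subgroup $\langle yz, zx\rangle$ equals $G$ (otherwise it has index two and the map is orientable). $M$ is self-dual if and only if $G$ has an automorphism interchanging $x$ and $y$ and fixing $z$; $M$ is self-Petrie-dual if and only if $G$ has an automorphism interchanging $x$ and $xy$ and fixing $y$ and $z$. The congruence condition means $p\equiv\pm1$ modulo $2k$ and $p\equiv\pm1$ modulo $12$ (signs possibly different). *)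

(* Defs.v *)
From HB Require Import structures.
From mathcomp Require Import all_boot all_order all_fingroup all_algebra all_solvable.

Set Implicit Arguments.
Unset Strict Implicit.
Unset Printing Implicit Defensive.

Import GroupScope.

Definition SL2 (p : nat) : {set {'GL_2(p)}} :=
  [set u | (\det (GLval u) == 1)%R].

Lemma SL2_group_set p : group_set (SL2 p).
Proof.
apply/group_setP; split; first by rewrite inE GL_1E det1.
by move=> u v; rewrite !inE GL_MxE det_mulmx => /eqP-> /eqP->; rewrite GRing.mulr1.
Qed.

Canonical SL2_group p := Group (SL2_group_set p).

(* Meaningful only for p prime: 'F_p is the field with p elements in that case. *)
Definition PSL2 (p : nat) : {set coset_of 'Z(SL2 p)} := SL2 p / 'Z(SL2 p).

Canonical PSL2_group p := [group of PSL2 p].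

(* The algebraic presentation (G; x, y, z) of a finite regular map; x != y is
   not imposed.                                                              *)
Record regular_map := RegularMap {
  map_gT : finGroupType;
  map_aut : {group map_gT};
  map_x : map_gT;
  map_y : map_gT;
  map_z : map_gT;
  map_x_involution : #[map_x] = 2;
  map_y_involution : #[map_y] = 2;
  map_z_involution : #[map_z] = 2;
  map_xy_commute : commute map_x map_y;
  map_generated : <<[set map_x; map_y; map_z]>> = map_aut;
  map_valency_ge3 : 3 <= #[map_y * map_z];
  map_face_length_ge3 : 3 <= #[map_z * map_x]
}.

Definition valency (M : regular_map) : nat := #[map_y M * map_z M].

Definition nonorientable (M : regular_map) : Prop :=
  <<[set map_y M * map_z M; map_z M * map_x M]>> = map_aut M.

Definition self_dual (M : regular_map) : Prop :=
  exists f : {perm map_gT M},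
    [/\ f \in Aut (map_aut M),
        f (map_x M) = map_y M, f (map_y M) = map_x M & f (map_z M) = map_z M].

Definition self_Petrie_dual (M : regular_map) : Prop :=
  exists f : {perm map_gT M},
    [/\ f \in Aut (map_aut M),
        f (map_x M) = map_x M * map_y M, f (map_x M * map_y M) = map_x M,
        f (map_y M) = map_y M & f (map_z M) = map_z M].

Definition congruent_pm1 (p m : nat) : Prop :=
  (p%:Z = 1 %[mod m%:Z])%Z \/ (p%:Z = -1 %[mod m%:Z])%Z.

(* Main.v *)
Require Import Defs.
From mathcomp Require Import all_boot all_order all_fingroup all_algebra all_solvable.
From mathcomp Require Import all_field.
From mathcomp Require Import zify ring.

Set Implicit Arguments.
Unset Strict Implicit.
Unset Printing Implicit Defensive.

Import GRing.Theory Num.Theory.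

(** Write [(1 + sqrt (-2)) ^ k = V + U sqrt (-2)].  A 2-adic estimate gives
    [U <> 1, -1], and [p] is taken to be a prime factor of [U].  Then
    [V ^ 2 = 3 ^ k] modulo [p] with [k] odd, so 3 is a square modulo [p], whence
    [p = 1, -1] modulo 12.

    Identify the 2 x 2 matrices over ['F_p] with the quaternions and let [x], [y], [z]
    be the classes in [PSL(2, p)] of [i], [j] and [(i + j + ij) / sqrt 3].  Both [yz] and
    [zx] are classes of elements of the form [1 + w] with [w ^ 2 = -2], up to scalars,
    so that they have order [k] because [p] divides [U]; hence [k] divides
    [p (p - 1) ^ 2 (p + 1)], and [k <> p] by comparing traces.  Conjugation by [i - j]
    and by [i - ij] gives the duality and the Petrie duality.

    It remains to see that the lifts of [yz] and [zx], together with [-1], generate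
    [SL(2, p)].  They act irreducibly, so by Bruhat decomposition it is enough that [p]
    divides the order of the group they generate, or that of the larger group [K]
    obtained by adjoining [i], [j] and [c = (1 + i + j + ij) / 2].  If it did not, the
    centralizers in [K] of noncentral elements would be abelian and Dickson's count of
    their conjugates would force the centralizer of [c], which has order at least 6
    modulo the center of [K], to have index at most 2; but the square of the lift of
    [yz] does not commute with [c]. *)

(** * Powers of 1 + sqrt (-2) and their residues *)

(* [(lucas n).1 + (lucas n).2 * sqrt (-2) = (1 + sqrt (-2)) ^ n] *)
Fixpoint lucas (n : nat) : int * int :=
  if n is m.+1 then
    let: (v, u) := lucas m in (v - 2 * u, v + u)%R
  else (1, 0)%R.

Lemma lucasS n :
  lucas n.+1 = ((lucas n).1 - 2 * (lucas n).2, (lucas n).1 + (lucas n).2)%R.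
Proof. by rewrite /=; case: (lucas n). Qed.

Lemma lucasD m n :
  lucas (m + n) = ((lucas m).1 * (lucas n).1 - 2 * (lucas m).2 * (lucas n).2,
                   (lucas m).1 * (lucas n).2 + (lucas m).2 * (lucas n).1)%R.
Proof.
elim: m => [|m IHm]; first by case: (lucas n) => v u /=; congr pair; ring.
by rewrite addSn !lucasS IHm /=; congr pair; ring.
Qed.

(** The norm of Z[sqrt (-2)] is multiplicative, and 1 + sqrt (-2) has norm 3. *)
Lemma lucas_norm n : ((lucas n).1 ^+ 2 + 2 * (lucas n).2 ^+ 2 = 3 ^+ n :> int)%R.
Proof.
elim: n => [|n IHn]; first by [].
by rewrite lucasS [RHS]GRing.exprS -IHn /=; ring.
Qed.

(* [(1 + sqrt (-2)) ^ N = 1 + 2 ^ (m + 2) sqrt (-2)] modulo [2 ^ (m + 3)]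
   when [m + 2] is the exact power of 2 in [N]. *)
Lemma lucas_2adic m r : exists a b : int,
  lucas (4 * 2 ^ m * (2 * r + 1)) =
    (1 + 8 * 2 ^+ m * a, 4 * 2 ^+ m * (1 + 2 * b))%R.
Proof.
elim: m => [|m [a [b E]]].
  elim: r => [|r [a [b E]]]; first by exists (-1)%R, (-1)%R.
  rewrite (_ : 4 * 2 ^ 0 * (2 * r.+1 + 1) = 8 + 4 * 2 ^ 0 * (2 * r + 1))%N; last by lia.
  rewrite lucasD E (_ : lucas 8 = (17, 56)%R) //=.
  exists (2 + 17 * a - 56 * (1 + 2 * b))%R, (15 + 56 * a + 17 * b)%R.
  by rewrite !GRing.expr0; congr pair; ring.
have -> : 4 * 2 ^ m.+1 * (2 * r + 1) =
          4 * 2 ^ m * (2 * r + 1) + 4 * 2 ^ m * (2 * r + 1).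
  by rewrite expnS; lia.
rewrite lucasD E /=.
exists (a + 4 * 2 ^+ m * a ^+ 2 - 2 * 2 ^+ m * (1 + 2 * b) ^+ 2)%R.
exists (b + 4 * 2 ^+ m * a * (1 + 2 * b))%R.
by rewrite (GRing.exprS 2 m); congr pair; ring.
Qed.

(** Two further factors send (V, U) to (-V - 4 U, 2 V - U), which keeps V odd and U = 1 modulo 4. In
    particular U is odd and is neither 0 nor -1. *)
Lemma lucas_odd_mod4 n : odd n -> exists a b : int,
  lucas n = (1 + 2 * a, 1 + 4 * b)%R.
Proof.
move=> n_odd; have -> : n = n./2 * 2 + 1.
  by rewrite -{1}(odd_double_half n) n_odd; lia.
suff [a [b [-> | ->]]] : exists a b : int,
    lucas (n./2 * 2 + 1) = (1 + 4 * a, 1 + 4 * b)%R \/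
    lucas (n./2 * 2 + 1) = (3 + 4 * a, 1 + 4 * b)%R.
- by exists (2 * a)%R, b; congr pair; ring.
- by exists (1 + 2 * a)%R, b; congr pair; ring.
elim: (n./2) => [|m [a [b E]]]; first by exists 0%R, 0%R; left.
rewrite (_ : m.+1 * 2 + 1 = 2 + (m * 2 + 1)); last by lia.
rewrite lucasD (_ : lucas 2 = (-1, 2)%R) //.
case: E => E; rewrite E /=.
  exists (-2 - a - 4 * b)%R, (2 * a - b)%R; right; congr pair; ring.
exists (-2 - a - 4 * b)%R, (1 + 2 * a - b)%R; left; congr pair; ring.
Qed.

(** Exponents 1 and 3 both give U = 1. For n = n0 + N with n0 among them and N divisible by 4, the
    factor of exponent N changes U by a number of the same 2-adic valuation as N, hence not by 0. *)
Lemma lucas_odd_neq1 n : odd n -> (5 <= n)%N -> (lucas n).2 != 1%R.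
Proof.
move=> n_odd n_ge5.
have [n0 [q [n0v q_gt0 En]]] : exists n0 q,
    [/\ n0 = 1%N \/ n0 = 3%N, (0 < q)%N & n = n0 + 4 * q].
  exists (n %% 4), (n %/ 4); split; [|lia|lia].
  by have := divn_eq n 4; have := ltn_pmod n (isT : 0 < 4); lia.
have [m [r Eq]] : exists m r, q = 2 ^ m * (2 * r + 1).
  exists (logn 2 q), (q %/ 2 ^ logn 2 q)./2.
  have [r co2r Eq] := pfactor_coprime (isT : prime 2) q_gt0.
  rewrite {3}Eq mulnK ?expn_gt0 // {1}Eq mulnC; congr muln.
  by move: co2r; rewrite coprime2n => r_odd; lia.
have [a [b EN]] := lucas_2adic m r.
rewrite En Eq mulnA lucasD EN.
have p2 : (0 < 2 ^+ m :> int)%R by rewrite Num.Theory.exprn_gt0.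
set P := (2 ^+ m)%R in p2 *.
apply/eqP => E.
case: n0v => E0; move: E; rewrite {}E0 /=; move=> E.
  have : (P * (4 * (1 + 2 * a + 2 * b)) = 0)%R by move: E; lia.
  by move/eqP; rewrite GRing.mulf_eq0 => /orP[] /eqP; lia.
have : (P * (4 * (- 5 + 2 * a - 10 * b)) = 0)%R by move: E; lia.
by move/eqP; rewrite GRing.mulf_eq0 => /orP[] /eqP; lia.
Qed.

(** Modulo 3 the pair alternates between (1, 1) and (2, 2), so 3 does not divide U. *)
Lemma lucas_mod3 n : exists b : int,
  (lucas n.+1).2 = (1 + 3 * b)%R \/ (lucas n.+1).2 = (2 + 3 * b)%R.
Proof.
suff : exists a b : int, [\/
    lucas n.+1 = (1 + 3 * a, 1 + 3 * b)%R | lucas n.+1 = (2 + 3 * a, 2 + 3 * b)%R].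
  by case=> a [b [-> | ->]]; exists b; [left | right].
elim: n => [|n [a [b E]]]; first by exists 0%R, 0%R; left.
rewrite lucasS; case: E => ->; rewrite /=.
  exists (-1 + a - 2 * b)%R, (a + b)%R; right; congr pair; ring.
exists (-1 + a - 2 * b)%R, (1 + a + b)%R; left; congr pair; ring.
Qed.

(** * Squares and roots of unity in finite fields *)

Section FiniteFieldSquares.

Local Open Scope ring_scope.

Lemma finField_prim_root (F : finFieldType) n :
  (n %| #|F|.-1)%N -> exists z : F, n.-primitive_root z.
Proof.
have [x Dx] := cyclicP (field_unit_group_cyclic [set: {unit F}]).
have ox : #[x]%g = #|F|.-1 by rewrite orderE -Dx card_finField_unit.
have q_gt0 : (0 < #|F|.-1)%N by rewrite -ox order_gt0.
have [||m prim_m m_dv] := @prim_order_exists F #|F|.-1 (val x) => //.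
  by rewrite -FinRing.val_unitX -ox expg_order.
have : (#|F|.-1 %| m)%N.
  rewrite -ox order_dvdn; apply/eqP/val_inj.
  by rewrite FinRing.val_unitX prim_expr_order.
move=> dv_m n_dv; have Em : m = #|F|.-1 by apply/eqP; rewrite eqn_dvd m_dv.
by exists (val x ^+ (m %/ n)); apply: dvdn_prim_root; rewrite ?Em // -Em.
Qed.

Lemma expf_card_pred (F : finFieldType) (x : F) : x != 0 -> x ^+ #|F|.-1 = 1.
Proof.
move=> x_nz; apply: (mulfI x_nz).
by rewrite mulr1 -exprS prednK ?expf_card //; apply/card_gt0P; exists x.
Qed.

Section SquareRootsModP.

Variables (p : nat) (p_pr : prime p).

Lemma Fp_natr_eq0 n : (n%:R == 0 :> 'F_p) = (p %| n)%N.
Proof. by rewrite (dvdn_pcharf (pchar_Fp p_pr)). Qed.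

Lemma Fp_sqrtN1_mod4 (i : 'F_p) : (2 < p)%N -> i ^+ 2 = -1 -> (4 %| p.-1)%N.
Proof.
move=> p_gt2 i2.
have N1 : (-1 : 'F_p) != 1.
  rewrite -subr_eq0 -opprD oppr_eq0 -(natrD _ 1 1) Fp_natr_eq0.
  by apply/negP => /dvdn_leq; lia.
have i_nz : i != 0.
  by apply/eqP => i0; move: i2 => /eqP; rewrite i0 expr0n eq_sym oppr_eq0 oner_eq0.
have := expf_card_pred i_nz; rewrite card_Fp // => ip.
have odd_p : odd p by case: (even_prime p_pr) p_gt2 => [->|].
have [//|ndv] := boolP (4 %| p.-1)%N; case/eqP: N1.
have Ep : p.-1 = (2 * (2 * (p.-1 %/ 4) + 1))%N.
  by have := divn_eq p.-1 4; lia.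
by rewrite -[RHS]ip Ep exprM i2 exprD exprM sqrrN !expr1n mul1r expr1.
Qed.

Lemma Fp_cubic_root1_mod3 (w : 'F_p) :
  p != 3%N -> w ^+ 2 + w + 1 = 0 -> (3 %| p.-1)%N.
Proof.
move=> p_neq3 Ew.
have w3 : w ^+ 3 = 1 by apply/eqP; rewrite -subr_eq0; apply/eqP; rewrite -(mul0r (w - 1)) -Ew; ring.
have w_nz : w != 0.
  by apply/eqP => w0; move: Ew; rewrite w0 => /eqP; rewrite expr0n !add0r oner_eq0.
have w_n1 : w != 1.
  apply: contraNneq p_neq3 => w1; move: Ew; rewrite w1 expr1n -(natrD _ 1 1) -(natrD _ 2 1).
  by move/eqP; rewrite Fp_natr_eq0 dvdn_prime2.
have := expf_card_pred w_nz; rewrite card_Fp // (divn_eq p.-1 3) mulnC exprD exprM w3 expr1n mul1r.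
have : (p.-1 %% 3 < 3)%N by rewrite ltn_pmod.
rewrite dvdn_addr ?dvdn_mulr //.
case: (p.-1 %% 3)%N => [|[|[|//]]] // _; first by rewrite expr1 => w1; rewrite w1 eqxx in w_n1.
move=> w2; move: w3; rewrite exprS w2 mulr1 => w1; by rewrite w1 eqxx in w_n1.
Qed.

(** As 3 is a square, -1 is a square exactly when -3 is; that is, 4 divides p - 1 exactly when 3
    does. *)
Lemma Fp_sqrt3_mod12 (s : 'F_p) : (3 < p)%N -> s ^+ 2 = 3 ->
  (12 %| p.-1)%N \/ (12 %| p.+1)%N.
Proof.
move=> p_gt3 s2.
have odd_p : odd p by case: (even_prime p_pr) p_gt3 => [->|].
have p_n3 : p != 3%N by rewrite neq_ltn p_gt3 orbT.
have nz3 : (3 : 'F_p) != 0 by rewrite Fp_natr_eq0 dvdn_prime2.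
have nz2 : (2 : 'F_p) != 0 by rewrite Fp_natr_eq0 dvdn_prime2 //; apply/eqP; lia.
have s_nz : s != 0 by apply: contraNneq nz3 => s0; rewrite -s2 s0 expr0n.
have mod3 : (3 %| p.-1)%N \/ (p %% 3 = 2)%N.
  have : ~~ (3 %| p)%N by rewrite dvdn_prime2 // eq_sym.
  by lia.
have [dv3|ndv3] := boolP (3 %| p.-1)%N.
  left; have [w w_pr] : exists w : 'F_p, 3.-primitive_root w.
    by apply: finField_prim_root; rewrite card_Fp.
  have w_n1 : w - 1 != 0.
    by rewrite subr_eq0 -{1}(expr1 w) -(prim_order_dvd w_pr).
  have Ew : w ^+ 2 + w + 1 = 0.
    apply: (mulIf w_n1); rewrite mul0r; transitivity (w ^+ 3 - 1); first by ring.
    by rewrite prim_expr_order // subrr.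
  have : (4 %| p.-1)%N.
    (* A primitive cube root of unity satisfies (2 w + 1)^2 = -3. *)
    apply: (@Fp_sqrtN1_mod4 ((2 * w + 1) / s)); first lia.
    rewrite expr_div_n s2; apply: (mulIf nz3); rewrite divfK //.
    transitivity (4 * (w ^+ 2 + w + 1) - 3 : 'F_p); first by ring.
    by rewrite Ew; ring.
  lia.
right; have [dv4|ndv4] := boolP (4 %| p.-1)%N; last by lia.
have [i i_pr] : exists i : 'F_p, 4.-primitive_root i.
  by apply: finField_prim_root; rewrite card_Fp.
have i2 : i ^+ 2 = -1.
  have : (i ^+ 2 - 1) * (i ^+ 2 + 1) = 0.
    transitivity (i ^+ 4 - 1); first by ring.
    by rewrite prim_expr_order // subrr.
  move/eqP; rewrite mulf_eq0 subr_eq0 -(prim_order_dvd i_pr) /= addr_eq0.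
  by move/eqP.
(* As (i s)^2 = -3, this element is a root of X^2 + X + 1. *)
case/negP: ndv3; apply: (@Fp_cubic_root1_mod3 ((i * s - 1) / 2)) => //.
apply: (mulIf nz2); apply: (mulIf nz2); rewrite !mul0r.
transitivity (i ^+ 2 * s ^+ 2 + 3); last by rewrite i2 s2; ring.
by field; rewrite nz2.
Qed.

End SquareRootsModP.

(** Pigeonhole: more than half of the elements are squares, so the squares meet their image under y
    -> -1 - y. The solution later splits the quaternion algebra. *)
Lemma finField_sum2sqr (F : finFieldType) : odd #|F| ->
  exists a b : F, a ^+ 2 + b ^+ 2 = -1.
Proof.
move=> odd_q; pose S := [set x ^+ 2 | x : F]; pose T := [set -1 - y | y in S].
have cardT : #|T| = #|S| by apply: card_imset => x y /addrI/oppr_inj.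
have cardS : (#|F| <= #|S| * 2)%N.
  have -> : #|F| = (\sum_(x : F) 1)%N by rewrite sum1_card.
  rewrite (partition_big (fun x : F => x ^+ 2) (mem S)); last first.
    by move=> x _; apply: imset_f.
  have -> : (#|S| * 2 = \sum_(y in S) 2)%N by rewrite sum_nat_const.
  apply: leq_sum => _ /imsetP[x _ ->].
  rewrite sum1dep_card (@leq_trans #|[set x; - x]|) //; last by rewrite cards2; case: (_ != _).
  by apply/subset_leq_card/subsetP => y; rewrite !inE eqf_sqr.
have [/pred0P dST|/pred0Pn[_ /andP[/imsetP[a _ ->] /imsetP[_ /imsetP[b _ ->] E]]]]
  := boolP [disjoint S & T].
  have : (#|S :|: T| <= #|F|)%N by exact: max_card.
  rewrite cardsU cardT.
  have -> : S :&: T = set0 by apply/setP => x; rewrite !inE; exact: dST.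
  by rewrite cards0; lia.
by exists a, b; rewrite E subrK.
Qed.

End FiniteFieldSquares.

(** * Dickson's count in groups with abelian centralizers *)

Import GroupScope.

(** [g], [z], [d] are the orders of a group, of its center and of the complement; [b], [m], [n] are
    sizes of blocks. If [m] and [n] are both g/4, then b < g/2 - z suffices; otherwise the sum is at
    least (5/12 + 1/4 + 1/3) g = g, more than [d]. *)
Lemma quarter_gap (g z d b m n : nat) : (0 < z -> d + z = g -> 2 * b + 2 * z < g ->
  5 * g <= 12 * b -> 4 * m = g \/ g <= 3 * m -> 4 * n = g \/ g <= 3 * n ->
  b + m + n <= d -> b + m + n < d)%N.
Proof. by move=> z0 dz l h [mE|m3] [nE|n3] le; lia. Qed.

Section AbelianCentralizers.

Variables (gT : finGroupType) (G : {group gT}).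

Hypothesis cent1_abelian : {in G :\: 'Z(G), forall x, abelian 'C_G[x]}.
Hypothesis cent1_conj : {in G :\: 'Z(G) & G, forall x h,
  x ^ h \in 'C_G[x] -> x ^ h = x \/ x ^ h = x^-1}.

Let B x := class_support ('C_G[x] :\: 'Z(G)) G.

(** An abelian centralizer of [u] containing [v] lies in the centralizer of [v], and the roles of
    [x] and [y] can be exchanged. *)
Lemma cent1_eq x y : x \in G :\: 'Z(G) -> y \in G :\: 'Z(G) ->
  y \in 'C_G[x] -> 'C_G[y] = 'C_G[x].
Proof.
suff sub u v : u \in G :\: 'Z(G) -> v \in G -> v \in 'C_G[u] -> 'C_G[u] \subset 'C_G[v].
  move=> nx ny yx; apply/eqP; rewrite eqEsubset.
  have [Gx Gy] : x \in G /\ y \in G by case/setDP: nx; case/setDP: ny.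
  by rewrite !sub // inE Gx cent1C; case/setIP: yx.
move=> nu Gv vu; apply/subsetP => w wu; rewrite inE; case/setIP: (wu) => -> _.
by apply/cent1P; apply: (centsP (cent1_abelian nu)).
Qed.

Lemma cent1_noncentral_mem x : x \in G :\: 'Z(G) -> x \in 'C_G[x] :\: 'Z(G).
Proof. by case/setDP=> Gx nZ; rewrite inE nZ inE Gx cent1id. Qed.

Lemma normedTI_cent1 x : x \in G :\: 'Z(G) ->
  normedTI ('C_G[x] :\: 'Z(G)) G 'N_G('C_G[x] :\: 'Z(G)).
Proof.
move=> nx; apply/normedTI_P; split=> // [|g Gg].
  by apply/set0Pn; exists x; apply: cent1_noncentral_mem.
case/pred0Pn=> y /= /andP[/setDP[Cy nZy]].
rewrite mem_conjg => /setDP[Cyg nZyg]; rewrite inE Gg /=.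
have Gy : y \in G by case/setIP: Cy.
have E1 : 'C_G[y] = 'C_G[x] by apply: cent1_eq => //; rewrite inE nZy.
have E2 : 'C_G[y ^ g^-1] = 'C_G[x].
  by apply: cent1_eq; rewrite // inE nZyg groupJ ?groupV.
apply/normP; rewrite conjDg (normsP (gFnorm _ _)) //; congr (_ :\: _).
rewrite -{1}E2 conjIg conjGid // -cent1J conjgKV; exact: E1.
Qed.

(** The normalizer moves [x] inside its centralizer, hence only to [x] or [x^-1]. *)
Lemma index_norm_cent1 x : x \in G :\: 'Z(G) ->
  exists2 e, e = 1%N \/ e = 2 & #|'N_G('C_G[x] :\: 'Z(G))| = (e * #|'C_G[x]|)%N.
Proof.
move=> nx; set N := 'N_G(_); have [Gx nZx] := setDP nx.
have sCN : 'C_G[x] \subset N.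
  rewrite subsetI subsetIl /=; apply/subsetP => h Ch; rewrite inE conjDg.
  by rewrite (normsP (gFnorm _ _)) ?conjGid //; case/setIP: Ch.
have -> : 'C_G[x] = 'C_N[x].
  apply/eqP; rewrite eqEsubset subsetI sCN subsetIr /=.
  by rewrite setSI // subsetIl.
exists #|N : 'C_N[x]|; last by rewrite mulnC Lagrange ?subsetIl.
have : (0 < #|N : 'C_N[x]| <= 2)%N.
  rewrite indexg_gt0 /= index_cent1 (@leq_trans #|[set x; x^-1]|) //; last first.
    by rewrite cards2; case: (_ != _).
  apply/subset_leq_card/subsetP => _ /imsetP[h /setIP[Gh nAh] ->].
  have /setDP[Cxh _] : x ^ h \in 'C_G[x] :\: 'Z(G).
    by rewrite -(normP nAh) memJ_conjg cent1_noncentral_mem.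
  by rewrite !inE; case: (cent1_conj nx Gh Cxh) => ->; rewrite eqxx ?orbT.
by case: #|N : _| => [|[|[|n]]] //; [left | right].
Qed.

(** [e] is the index of the centralizer in the normalizer, and [a] the order of the centralizer
    modulo the center. The |G| / (e a |Z(G)|) conjugates contribute (a - 1) |Z(G)| elements each,
    disjointly, so [B x] has density (a - 1) / (e a). *)
Lemma card_support_cent1 x : x \in G :\: 'Z(G) ->
  exists e a : nat, [/\ e = 1%N \/ e = 2, (1 < a)%N, #|'C_G[x]| = (a * #|'Z(G)|)%N &
     (#|B x| * (e * a) = (a - 1) * #|G|)%N].
Proof.
move=> nx; have [e De cN] := index_norm_cent1 nx.
have sZC : 'Z(G) \subset 'C_G[x].
  rewrite subsetI subsetIl /=; apply/subsetP => z /setIP[_ /centP Cz].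
  by apply/cent1P/Cz; case/setDP: nx.
have Ea := Lagrange sZC; rewrite mulnC in Ea.
exists e, #|'C_G[x] : 'Z(G)|; split=> //.
  rewrite indexg_gt1; apply/subsetPn; exists x; last by case/setDP: nx.
  by case/setDP: (cent1_noncentral_mem nx).
rewrite /B (card_support_normedTI (normedTI_cent1 nx)) cardsD.
have -> : 'C_G[x] :&: 'Z(G) = 'Z(G) by apply/setIidPr.
have := Lagrange (subsetIl G 'N('C_G[x] :\: 'Z(G))); rewrite cN -Ea => <-.
move: #|'C_G[x] : 'Z(G)| #|'Z(G)| #|G : 'N_G(_)| => a z i.
by rewrite -{2}(mul1n z) -mulnBl; move: (a - 1)%N => d; ring.
Qed.

(** Overlapping blocks come from conjugate centralizers, so [y] would lie in a conjugate of
    ['C_G[x]]. *)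
Lemma support_cent1_disjoint x y : x \in G :\: 'Z(G) -> y \in G :\: 'Z(G) ->
  y \notin B x -> [disjoint B x & B y].
Proof.
move=> nx ny; apply: contraR => /pred0Pn[w /= /andP[/imset2P[u g Cu Gg Ew]]].
case/imset2P=> v h Cv Gh Ew'.
have Eu : u = v ^ (h * g^-1) by rewrite conjgM -Ew' Ew conjgK.
have Ghg : h * g^-1 \in G by rewrite groupM ?groupV.
have [Cu1 Zu] := setDP Cu; have [Cv1 Zv] := setDP Cv.
have Gu : u \in G by case/setIP: Cu1.
have Gv : v \in G by case/setIP: Cv1.
have Eux : 'C_G[u] = 'C_G[x] by apply: cent1_eq => //; apply/setDP.
have Evy : 'C_G[v] = 'C_G[y] by apply: cent1_eq => //; apply/setDP.
apply/imset2P; exists (y ^ (h * g^-1)) (g * h^-1).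
- rewrite inE; apply/andP; split.
    by rewrite memJ_norm ?(subsetP (gFnorm _ _)) //; case/setDP: ny.
  have [Gy _] := setDP ny.
  rewrite -Eux Eu inE groupJ //= cent1J memJ_conjg.
  have : y \in 'C_G[v] by rewrite Evy inE Gy cent1id.
  by case/setIP.
- by rewrite groupM ?groupV.
by rewrite -conjgM mulgA mulgKV mulgV conjg1.
Qed.

Lemma support_cent1_sub x : x \in G :\: 'Z(G) -> B x \subset G :\: 'Z(G).
Proof.
move=> nx; apply/subsetP => _ /imset2P[u g /setDP[/setIP[Gu _] Zu] Gg ->].
apply/setDP; split; first exact: groupJ.
by rewrite memJ_norm // (subsetP (gFnorm _ _)).
Qed.

(* If [|G| > 2 |C_G[x]|], the part of [G] outside [Z(G)] and the conjugates of
   [C_G[x]] is nonempty, of density less than [1/6] or strictly between [1/2] and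
   [7/12].  It is a disjoint union of sets [B y], each of density [1/4], in
   [[1/3, 1/2]] or at least [2/3], and no sum of such densities fits. *)
Lemma index_cent1_le2 x : x \in G :\: 'Z(G) ->
  (6 * #|'Z(G)| <= #|'C_G[x]|)%N -> (#|G : 'C_G[x]| <= 2)%N.
Proof.
move=> nx big; rewrite leqNgt; apply/negP => ind_gt2.
have [e [a [De a_gt1 Ca cBx]]] := card_support_cent1 nx.
have z_gt0 : (0 < #|'Z(G)|)%N by rewrite cardG_gt0.
have a_ge6 : (6 <= a)%N by rewrite Ca leq_pmul2r in big.
have EG := Lagrange (subsetIl G 'C[x]); rewrite Ca in EG.
have gt2 : (2 * (a * #|'Z(G)|) < #|G|)%N.
  by rewrite -EG mulnC ltn_pmul2l ?muln_gt0 ?z_gt0 ?(ltnW a_gt1).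
have cD : (#|G :\: 'Z(G)| + #|'Z(G)| = #|G|)%N.
  by rewrite addnC -[RHS](cardsID 'Z(G)) (setIidPr (center_sub G)).
(* The density (a - 1) / (e a) is 1/4 for e = a = 2, at least 2/3 for e = 1 and a > 2, and between
   1/3 and 1/2 otherwise. *)
have quarter y : y \in G :\: 'Z(G) -> [\/ (4 * #|B y| = #|G|)%N,
    (3 * #|B y| >= #|G|)%N /\ (2 * #|B y| <= #|G|)%N | (3 * #|B y| >= 2 * #|G|)%N].
  move=> ny; have [e' [a' [De' a'_gt1 Ca' cBy]]] := card_support_cent1 ny.
  case: De' => De'; subst e'.
    have [a'2|a'_gt2] : a' = 2 \/ (2 < a')%N by lia.
      by subst a'; apply: Or32; lia.
    by apply: Or33; nia.
  have [a'2|a'_gt2] : a' = 2 \/ (2 < a')%N by lia.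
    by subst a'; apply: Or31; lia.
  by apply: Or32; nia.
have G_gt0 : (0 < #|G|)%N by rewrite cardG_gt0.
have pick (S : {set gT}) : S \subset G :\: 'Z(G) -> (#|S| < #|G :\: 'Z(G)|)%N ->
    exists2 y, y \in G :\: 'Z(G) & y \notin S.
  move=> sS ltS; have /subsetPn[y ny nSy] : ~~ (G :\: 'Z(G) \subset S).
    by apply: contraL ltS => /subset_leq_card; rewrite -leqNgt.
  by exists y.
have BS := support_cent1_sub; have Bdis := support_cent1_disjoint.
have cU (S T : {set gT}) : [disjoint S & T] -> #|S :|: T| = (#|S| + #|T|)%N.
  by move=> dST; rewrite cardsU disjoint_setI0 // cards0 subn0.
have ltx : (#|B x| < #|G :\: 'Z(G)|)%N by case: De => De; subst e; nia.
have [y ny Bxy] := pick _ (BS x nx) ltx.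
have dxy := Bdis x y nx ny Bxy.
have sxy : B x :|: B y \subset G :\: 'Z(G) by rewrite subUset !BS.
have cxy : #|B x :|: B y| = (#|B x| + #|B y|)%N := cU _ _ dxy.
have lexy : (#|B x| + #|B y| <= #|G :\: 'Z(G)|)%N by rewrite -cxy subset_leq_card.
have quy := quarter y ny.
(* With e = 1, [B x] has density at least 5/6 and leaves no room for [B y]. *)
case: De => De; subst e.
  have hi : (5 * #|G| <= 6 * #|B x|)%N by clear -cBx a_ge6; nia.
  by case: quy; lia.
(* With e = 2, [B x] has density at least 5/12, but falls short of half of [G] by more than
   |Z(G)|. *)
have lo : (2 * #|B x| + 2 * #|'Z(G)| < #|G|)%N by clear -cBx gt2 a_ge6; nia.
have hi : (5 * #|G| <= 12 * #|B x|)%N by clear -cBx a_ge6; nia.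
have ltxy : (#|B x :|: B y| < #|G :\: 'Z(G)|)%N by rewrite cxy; case: quy; lia.
have [w nw] := pick _ sxy ltxy; rewrite inE negb_or => /andP[Bxw Byw].
have sxyw : (B x :|: B y) :|: B w \subset G :\: 'Z(G) by rewrite subUset sxy BS.
have dxyw : [disjoint B x :|: B y & B w].
  by rewrite disjoints_subset subUset -!disjoints_subset !Bdis.
have cxyw : #|B x :|: B y :|: B w| = (#|B x| + #|B y| + #|B w|)%N.
  by rewrite cU // cxy.
have lexyw : (#|B x| + #|B y| + #|B w| <= #|G :\: 'Z(G)|)%N.
  by rewrite -cxyw subset_leq_card.
have quw := quarter w nw.
have ltxyw : (#|(B x :|: B y) :|: B w| < #|G :\: 'Z(G)|)%N.
  have {}quarter v : v \in G :\: 'Z(G) -> (4 * #|B v| = #|G| \/ #|G| <= 3 * #|B v|)%N.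
    case/quarter=> [|[? _]|le]; [by left | by right | right].
    by apply: leq_trans le; apply: leq_pmull.
  by rewrite cxyw; apply: (@quarter_gap _ _ _ _ _ _ z_gt0 cD lo hi) => //; apply: quarter.
have [t nt] := pick _ sxyw ltxyw; rewrite !inE !negb_or -andbA => /and3P[Bxt Byt Bwt].
have sxywt : (B x :|: B y :|: B w) :|: B t \subset G :\: 'Z(G).
  by rewrite subUset sxyw BS.
have dxywt : [disjoint B x :|: B y :|: B w & B t].
  by rewrite disjoints_subset !subUset -!disjoints_subset !Bdis.
have : (#|B x| + #|B y| + #|B w| + #|B t| <= #|G :\: 'Z(G)|)%N.
  by rewrite -cxyw -cU ?subset_leq_card.
(* Three further blocks of density at least 1/4 exceed the 7/12 that [B x] can leave. *)
have qu4 v : v \in G :\: 'Z(G) -> (#|G| <= 4 * #|B v|)%N by case/quarter; move: #|B v| #|G|; clear; lia.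
move: {qu4}(qu4 y ny) (qu4 w nw) (qu4 t nt) hi cD z_gt0.
by move: #|B x| #|B y| #|B w| #|B t| #|G :\: _| #|'Z(G)| #|G|; clear; lia.
Qed.

End AbelianCentralizers.

(** * Two by two matrices over a field *)

Section Matrix2.

Variable F : fieldType.
Local Open Scope ring_scope.
Implicit Types (A B : 'M[F]_2).

Definition mx2 (a b c d : F) : 'M[F]_2 :=
  \matrix_(i, j) (if i == 0 then if j == 0 then a else b
                  else if j == 0 then c else d).

Lemma ord2_cases (i : 'I_2) : i = 0 \/ i = 1.
Proof. by case: i => -[|[|//]] lt_i; [left | right]; apply: val_inj. Qed.

Lemma mx2_eta A : A = mx2 (A 0 0) (A 0 1) (A 1 0) (A 1 1).
Proof.
apply/matrixP => i j; rewrite mxE.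
by case: (ord2_cases i) => ->; case: (ord2_cases j) => ->.
Qed.

Lemma mx2_inj a b c d a' b' c' d' : mx2 a b c d = mx2 a' b' c' d' ->
  [/\ a = a', b = b', c = c' & d = d'].
Proof.
move/matrixP => E.
by have := E 0 0; have := E 0 1; have := E 1 0; have := E 1 1; rewrite !mxE.
Qed.

Lemma mul_mx2 a b c d a' b' c' d' : mx2 a b c d * mx2 a' b' c' d' =
  mx2 (a * a' + b * c') (a * b' + b * d') (c * a' + d * c') (c * b' + d * d').
Proof.
apply/matrixP => i j; rewrite !mxE big_ord_recl big_ord1 !mxE /=.
by case: (ord2_cases i) => ->; case: (ord2_cases j) => ->.
Qed.

Lemma add_mx2 a b c d a' b' c' d' : mx2 a b c d + mx2 a' b' c' d' =
  mx2 (a + a') (b + b') (c + c') (d + d').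
Proof.
apply/matrixP => i j; rewrite !mxE.
by case: (ord2_cases i) => ->; case: (ord2_cases j) => ->.
Qed.

Lemma scale_mx2 x a b c d : x *: mx2 a b c d = mx2 (x * a) (x * b) (x * c) (x * d).
Proof.
apply/matrixP => i j; rewrite !mxE.
by case: (ord2_cases i) => ->; case: (ord2_cases j) => ->.
Qed.

Lemma opp_mx2 a b c d : - mx2 a b c d = mx2 (- a) (- b) (- c) (- d).
Proof. by rewrite -scaleN1r scale_mx2 !mulN1r. Qed.

Lemma scalar_mx2 x : x%:M = mx2 x 0 0 x.
Proof.
apply/matrixP => i j; rewrite !mxE.
by case: (ord2_cases i) => ->; case: (ord2_cases j) => ->.
Qed.

Lemma one_mx2 : 1 = mx2 1 0 0 1 :> 'M[F]_2.
Proof. exact: (scalar_mx2 1). Qed.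

Lemma zero_mx2 : 0 = mx2 0 0 0 0 :> 'M[F]_2.
Proof. by rewrite -scalar_mx2 raddf0. Qed.

Lemma det_mx2 a b c d : \det (mx2 a b c d) = a * d - b * c.
Proof.
rewrite (expand_det_row _ 0) big_ord_recl big_ord1 /cofactor !mxE /=.
by rewrite !det_mx11 !mxE /= /bump /=; ring.
Qed.

Lemma mxtrace_mx2 a b c d : \tr (mx2 a b c d) = a + d.
Proof. by rewrite /mxtrace big_ord_recl big_ord1 !mxE. Qed.

Definition mx2E := (mul_mx2, add_mx2, opp_mx2, scale_mx2).

Lemma mx2_Cayley_Hamilton A : A * A = \tr A *: A - (\det A)%:M.
Proof.
rewrite (mx2_eta A); move: (A 0 0) (A 0 1) (A 1 0) (A 1 1) => a b c d.
rewrite mxtrace_mx2 det_mx2 scalar_mx2 !mx2E.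
by congr mx2; ring.
Qed.

(** A nonscalar [A] has a nonzero off-diagonal entry or distinct diagonal entries. This determines
    the coefficient of [A], and commutation yields the remaining equations. *)
Lemma comm_nonscalar_mx2 A B : ~~ is_scalar_mx A -> A * B = B * A ->
  exists x y, B = x%:M + y *: A.
Proof.
rewrite (mx2_eta A) (mx2_eta B).
move: (A 0 0) (A 0 1) (A 1 0) (A 1 1) (B 0 0) (B 0 1) (B 1 0) (B 1 1).
move=> a b c d e f g h nsA; rewrite !mul_mx2 => /mx2_inj[E1 E2 E3 _].
have sol x y : e = x + y * a -> f = y * b -> g = y * c -> h = x + y * d ->
    exists x y, mx2 e f g h = x%:M + y *: mx2 a b c d.
  by move=> -> -> -> ->; exists x, y; rewrite scalar_mx2 !mx2E !add0r.
have [b0|b_nz] := eqVneq b 0; last first.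
  apply: (sol (e - f / b * a) (f / b)).
  - by field.
  - by field.
  - apply: (mulfI b_nz); transitivity (b * g); first by [].
    transitivity (f * c); last by field.
    by apply: (addrI (a * e)); rewrite E1; ring.
  - apply: (mulfI b_nz); transitivity (a * f + b * h - a * f); first by ring.
    by rewrite E2; field.
have [c0|c_nz] := eqVneq c 0; last first.
  apply: (sol (e - g / c * a) (g / c)).
  - by field.
  - apply: (mulfI c_nz); transitivity (e * a + f * c - a * e); first by ring.
    by rewrite -E1; field.
  - by field.
  - apply: (mulfI c_nz); transitivity (g * a + h * c - g * a); first by ring.
    by rewrite -E3; field.
have [ad|ad_nz] := eqVneq a d.
  by case/negP: nsA; rewrite b0 c0 ad -scalar_mx2 scalar_mx_is_scalar.
rewrite b0 c0 in E2 E3.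
have ad_nz' : a - d != 0 by rewrite subr_eq0.
apply: (sol (e - (e - h) / (a - d) * a) ((e - h) / (a - d))).
- by field.
- rewrite b0 mulr0; apply: (mulfI ad_nz'); rewrite mulr0.
  by transitivity (a * f + 0 * h - (e * 0 + f * d)); [ring | rewrite E2 subrr].
- rewrite c0 mulr0; apply: (mulfI ad_nz'); rewrite mulr0.
  by transitivity (g * a + h * 0 - (0 * e + d * g)); [ring | rewrite E3 subrr].
- by field.
Qed.

Lemma comm_nonscalar_mx2_trans A B C : ~~ is_scalar_mx A ->
  A * B = B * A -> A * C = C * A -> B * C = C * B.
Proof.
move=> nsA /(comm_nonscalar_mx2 nsA)[x [y ->]] /(comm_nonscalar_mx2 nsA)[z [t ->]].
rewrite (mx2_eta A) !scalar_mx2 !mx2E.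
by congr mx2; ring.
Qed.

(** The discriminant of x + y A is y^2 times that of A, and both equal tr(A)^2 - 4, which is
    nonzero. So y is 1 or -1, and the trace determines x: the matrix is A or tr(A) - A, the inverse
    of A. *)
Lemma det1_mx2_conj_pencil A x y : 2 != 0 :> F -> \det A = 1 ->
    \tr A ^+ 2 != 4 ->
    \tr (x%:M + y *: A) = \tr A -> \det (x%:M + y *: A) = 1 ->
  x%:M + y *: A = A \/ A * (x%:M + y *: A) = 1.
Proof.
move=> nz2; rewrite (mx2_eta A) scalar_mx2 !mx2E !mxtrace_mx2 !det_mx2.
move: (A 0 0) (A 0 1) (A 1 0) (A 1 1) => a b c d dA trA Etr Edet.
have : ((a + d) ^+ 2 - 4) * ((1 - y) * (1 + y)) = 0.
  have -> : ((a + d) ^+ 2 - 4) * ((1 - y) * (1 + y)) =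
      ((a + d) ^+ 2 - (x + y * a + (x + y * d)) ^+ 2) +
      4 * ((x + y * a) * (x + y * d) - (0 + y * b) * (0 + y * c) - 1)
      + 4 * y ^+ 2 * (1 - (a * d - b * c)) by ring.
  by rewrite Etr Edet dA; ring.
move/eqP; rewrite mulf_eq0 subr_eq0 (negPf trA) /= mulf_eq0 subr_eq0 => /orP[] /eqP Ey.
  left; have x0 : x = 0.
    apply: (mulfI nz2); rewrite mulr0; transitivity (x + y * a + (x + y * d) - (a + d)).
      by rewrite -Ey; ring.
    by rewrite Etr subrr.
  by rewrite -Ey x0 !add0r !mul1r.
have Ey1 : y = -1 by apply/eqP; rewrite -addr_eq0 addrC; apply/eqP.
have Ex : x = a + d.
  apply: (mulfI nz2); transitivity (x + y * a + (x + y * d) + (a + d)).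
    by rewrite Ey1; ring.
  by rewrite Etr; ring.
right; rewrite Ex Ey1 one_mx2; congr mx2; rewrite -?[RHS]dA; ring.
Qed.

Lemma detX A n : \det (A ^+ n) = \det A ^+ n.
Proof. by elim: n => [|n IHn]; rewrite ?det1 // !exprS det_mulmx IHn. Qed.

Lemma mx2_nilpotent A n : A ^+ n.+1 = 0 -> A ^+ 2 = 0.
Proof.
move=> An; have dA : \det A = 0.
  have : \det A ^+ n.+1 == 0 by rewrite -detX An det0.
  by rewrite expf_eq0 => /eqP.
have A2 : A * A = \tr A *: A by rewrite mx2_Cayley_Hamilton dA raddf0 subr0.
have EA m : A ^+ m.+1 = (\tr A) ^+ m *: A.
  elim: m => [|m IHm]; first by rewrite expr0 scale1r expr1.
  by rewrite exprS IHm -scalerAr A2 scalerA -exprSr.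
move: An; rewrite EA => /eqP; rewrite scaler_eq0 expf_eq0 => /orP[/andP[_ /eqP t0] | /eqP->].
  by rewrite expr2 A2 t0 scale0r.
by rewrite expr0n.
Qed.

Lemma mx2_double_root A e :
  \det A = e ^+ 2 -> \tr A = 2 * e -> (A - e%:M) ^+ 2 = 0.
Proof.
rewrite (mx2_eta A) det_mx2 mxtrace_mx2.
move: (A 0 0) (A 0 1) (A 1 0) (A 1 1) => a b c d Ed Et.
have Dd : d = 2 * e - a by rewrite -Et; ring.
have bc : b * c = a * d - e ^+ 2 by rewrite -Ed; ring.
rewrite expr2 scalar_mx2 !mx2E zero_mx2; congr mx2.
- by transitivity ((a - e) ^+ 2 + b * c); [ring | rewrite bc Dd; ring].
- by rewrite Dd; ring.
- by rewrite Dd; ring.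
- by transitivity ((d - e) ^+ 2 + b * c); [ring | rewrite bc Dd; ring].
Qed.

End Matrix2.

(** * Matrices over F_p and their p-th powers *)

Section MatrixFp.

Variables (p : nat) (p_pr : prime p).
Local Open Scope ring_scope.
Implicit Types (A : 'M['F_p]_2).

Lemma Fp_expr_card (x : 'F_p) : x ^+ p = x.
Proof. by have := expf_card x; rewrite card_Fp. Qed.

Lemma mx2_subr_scalar_expp A c : (A - c%:M) ^+ p = A ^+ p - c%:M.
Proof.
have pcharM : p \in [pchar 'M['F_p]_2] by rewrite pchar_lalg pchar_Fp.
have := @pFrobenius_autD_comm _ _ pcharM A (- c%:M).
rewrite !pFrobenius_autE => ->; last first.
  by apply: commrN; apply: comm_mx_sym; apply: comm_scalar_mx.
by congr (_ + _); rewrite -raddfN -rmorphXn /= Fp_expr_card.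
Qed.

Lemma mx2_expp_scalar A c : A ^+ p = c%:M -> (A - c%:M) ^+ 2 = 0.
Proof.
move=> Ap; apply: (@mx2_nilpotent _ _ p.-1).
by rewrite prednK ?prime_gt0 // mx2_subr_scalar_expp Ap subrr.
Qed.

(** [A] has the double eigenvalue [c], so its discriminant vanishes. This later separates [k] from
    [p]. *)
Lemma mx2_expp_scalar_trace A c : A ^+ p = c%:M -> \tr A ^+ 2 = 4 * \det A.
Proof.
move=> /mx2_expp_scalar; rewrite (mx2_eta A) scalar_mx2 expr2 !mx2E.
rewrite zero_mx2 mxtrace_mx2 det_mx2 => /mx2_inj[].
move: (A 0 0) (A 0 1) (A 1 0) (A 1 1) => a b c' d E1 E2 E3 E4.
have [t0|t_nz] := eqVneq (a + d - 2 * c) 0.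
  have -> : d = 2 * c - a by rewrite -[RHS]addr0 -t0; ring.
  apply/eqP; rewrite -subr_eq0; apply/eqP; rewrite -(mulr0 4) -E1; ring.
have b0 : b = 0 by apply: (mulfI t_nz); rewrite mulr0 -E2; ring.
have c0 : c' = 0 by apply: (mulfI t_nz); rewrite mulr0 -E3; ring.
have -> : a = d.
  apply/eqP; rewrite -subr_eq0; apply/eqP; apply: (mulfI t_nz).
  rewrite mulr0; transitivity (((a - c) * (a - c) + (b - 0) * (c' - 0)) -
    ((c' - 0) * (b - 0) + (d - c) * (d - c))); first by ring.
  by rewrite E1 E4 subrr.
by rewrite b0; ring.
Qed.

End MatrixFp.

(** * Subgroups of SL(2, p) of order prime to p *)

Section SpecialLinear2.

Variables (p : nat) (p_pr : prime p).
Implicit Types (u v h : {'GL_2(p)}) (G : {group {'GL_2(p)}}).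

Definition GLmx u : 'M['F_p]_2 := GLval u.

Lemma GLmxM u v : GLmx (u * v) = (GLmx u * GLmx v)%R. Proof. by []. Qed.
Lemma GLmx_inj : injective GLmx. Proof. exact: val_inj. Qed.
Lemma GLmxX u n : GLmx (u ^+ n) = (GLmx u ^+ n)%R.
Proof. exact: FinRing.val_unitX. Qed.

Lemma SL2_det u : u \in SL2 p -> (\det (GLmx u) = 1)%R.
Proof. by rewrite inE => /eqP. Qed.

Lemma GLmx_scalar_commute u v : is_scalar_mx (GLmx u) -> commute u v.
Proof.
case/is_scalar_mxP => c Eu; apply: GLmx_inj; rewrite !GLmxM Eu.
exact: comm_scalar_mx.
Qed.

Lemma GLmx_commuteP u v : commute u v <-> (GLmx u * GLmx v = GLmx v * GLmx u)%R.
Proof.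
split=> [cuv | E]; first by rewrite -!GLmxM cuv.
by apply: GLmx_inj; rewrite !GLmxM.
Qed.

Lemma GLmxJ u h : (GLmx h * GLmx (u ^ h) = GLmx u * GLmx h)%R.
Proof. by rewrite -!GLmxM -conjgC. Qed.

Lemma mxtrace_GLmxJ u h : (\tr (GLmx (u ^ h)) = \tr (GLmx u))%R.
Proof.
have -> : GLmx (u ^ h) = (GLmx h^-1 * (GLmx u * GLmx h))%R by rewrite -!GLmxM.
rewrite mxtrace_mulC.
have -> : (GLmx u * GLmx h *m GLmx h^-1 = GLmx u)%R.
  by change (GLmx (u * h * h^-1) = GLmx u); rewrite mulgK.
by [].
Qed.

Section PPrimeSubgroup.

Variable G : {group {'GL_2(p)}}.
Hypotheses (p_gt2 : 2 < p) (sGS : G \subset SL2 p) (p'G : ~~ (p %| #|G|)).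

Lemma noncentral_nonscalar u : u \in G :\: 'Z(G) -> ~~ is_scalar_mx (GLmx u).
Proof.
case/setDP=> Gu; apply: contra => sc_u; rewrite inE Gu /=.
by apply/centP => v _; apply: GLmx_scalar_commute.
Qed.

(** If the trace were 2 e with e^2 = 1, then (u - e)^2 = 0, so u^p = e and u^(2p) = 1. The order of
    u being prime to p, u^2 = 1, and Cayley-Hamilton would make u the scalar e. *)
Lemma pprime_trace_neq u : u \in G :\: 'Z(G) -> (\tr (GLmx u) ^+ 2 != 4)%R.
Proof.
move=> nu; have ns_u := noncentral_nonscalar nu; have [Gu _] := setDP nu.
have nz2 : (2 != 0 :> 'F_p)%R by rewrite Fp_natr_eq0 // gtnNdvd.
apply/negP => /eqP t2.
have [e e2 te] : exists2 e : 'F_p, (e ^+ 2 = 1)%R & (\tr (GLmx u) = 2 * e)%R.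
  exists (\tr (GLmx u) / 2)%R; last by rewrite mulrCA divff // mulr1.
  rewrite expr_div_n t2 (_ : 4%R = 2 ^+ 2)%R; last by ring.
  by rewrite divff // expf_neq0.
have N2 : ((GLmx u - e%:M) ^+ 2 = 0)%R.
  by apply: mx2_double_root; rewrite ?SL2_det ?(subsetP sGS).
have up : (GLmx u ^+ p = e%:M)%R.
  apply/eqP; rewrite -subr_eq0 -mx2_subr_scalar_expp //.
  have Nm m : (1 < m)%N -> ((GLmx u - e%:M) ^+ m = 0)%R.
    by move/subnK <-; rewrite exprD N2 mulr0.
  by rewrite Nm // ltnW.
have u2p : u ^+ (p * 2) = 1.
  by apply: GLmx_inj; rewrite GLmxX exprM up -rmorphXn /= e2.
have co : coprime #[u] p.
  rewrite coprime_sym prime_coprime //.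
  by apply: contra p'G => /dvdn_trans-> //; apply: order_dvdG.
have : #[u] %| 2 by rewrite -(Gauss_dvdr _ co) order_dvdn u2p.
rewrite order_dvdn => /eqP u2.
case/negP: ns_u; apply/is_scalar_mxP; exists e.
have /eqP : GLmx (u ^+ 2) = 1%R by rewrite u2.
rewrite GLmxX expr2 mx2_Cayley_Hamilton te SL2_det ?(subsetP sGS) //.
rewrite subr_eq -scalerA => /eqP E.
have : (2 *: (e *: GLmx u) = 2 *: (1 : 'M_2))%R.
  by rewrite E (scaler_nat 2) mulr2n.
move/(scalerI nz2)/(congr1 ( *:%R e)); rewrite scalerA -expr2 e2 scale1r => ->.
by rewrite -scalemx1.
Qed.

(** Both hypotheses of the count hold: matrices commuting with a nonscalar one commute with each
    other, and a conjugate of [y] commuting with [y] is a + b y with the same trace and determinant,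
    hence [y] or its inverse. *)
Lemma pprime_index_cent1 x : x \in G :\: 'Z(G) ->
  (6 * #|'Z(G)| <= #|'C_G[x]|)%N -> (#|G : 'C_G[x]| <= 2)%N.
Proof.
have nz2 : (2 != 0 :> 'F_p)%R by rewrite Fp_natr_eq0 // gtnNdvd.
apply: index_cent1_le2 => [y ny | y h ny Gh].
  apply/centsP => v /setIP[Gv /cent1P cv] w /setIP[Gw /cent1P cw].
  apply/GLmx_commuteP; apply: (comm_nonscalar_mx2_trans (noncentral_nonscalar ny));
  by apply/GLmx_commuteP.
case/setIP=> Gyh /cent1P cyh; have [Gy _] := setDP ny.
have [|a [b Eyh]] := @comm_nonscalar_mx2 _ _ (GLmx (y ^ h)) (noncentral_nonscalar ny).
  by apply/GLmx_commuteP.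
have := @det1_mx2_conj_pencil _ (GLmx y) a b nz2.
rewrite -Eyh mxtrace_GLmxJ !SL2_det ?(subsetP sGS) //.
case=> //; [exact: pprime_trace_neq | by left; apply: GLmx_inj|].
move=> E; right; apply/eqP; rewrite eq_sym eq_invg_mul; apply/eqP.
by apply: GLmx_inj; rewrite GLmxM.
Qed.

End PPrimeSubgroup.

End SpecialLinear2.

(** * Irreducible subgroups containing an element of order p *)

Section Generation.

Variables (p : nat) (p_pr : prime p).
Local Open Scope ring_scope.

(** Singular matrices get the default value 1. *)
Definition GLof (A : 'M['F_p]_2) : {'GL_2(p)} := insubd (1%g : {'GL_2(p)}) A.

Lemma GLofK A : \det A != 0 -> GLmx (GLof A) = A.
Proof.
move=> dA; have uA : A \in unitmx by rewrite unitmxE unitfE.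
change (val (GLof A) = A); rewrite val_insubd.
by case: ifP => // /negP[]; exact: uA.
Qed.

Definition GLmem (H : {group {'GL_2(p)}}) (A : 'M['F_p]_2) : Prop :=
  exists2 h, h \in H & GLmx h = A.

Lemma GLmemM H A B : GLmem H A -> GLmem H B -> GLmem H (A * B).
Proof. by move=> [h Hh <-] [k Hk <-]; exists (h * k)%g; rewrite ?groupM. Qed.

Lemma GLmemX H A n : GLmem H A -> GLmem H (A ^+ n).
Proof. by move=> [h Hh <-]; exists (h ^+ n)%g; rewrite ?groupX ?GLmxX. Qed.

Lemma SL2_sub_transvection (H : {group {'GL_2(p)}}) a b c d :
    GLmem H (mx2 1 1 0 1) -> GLmem H (mx2 a b c d) -> c != 0 ->
  a * d - b * c = 1 -> SL2 p \subset H.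
Proof.
move=> H1 Hh c_nz dh.
have up t : GLmem H (mx2 1 t 0 1).
  have EX n : mx2 1 1 0 1 ^+ n = mx2 1 n%:R 0 1 :> 'M['F_p]_2.
    elim: n => [|n IHn]; first by rewrite expr0 one_mx2.
    by rewrite exprS IHn mul_mx2 -natr1; congr mx2; ring.
  by have := GLmemX (t : nat) H1; rewrite EX natr_Zp.
have Hw : GLmem H (mx2 0 (- c^-1) c 0).
  have := GLmemM (GLmemM (up (- a / c)) Hh) (up (- d / c)); rewrite !mul_mx2.
  congr (GLmem H); congr mx2; try by field.
  apply: (mulIf c_nz); transitivity (- (a * d - b * c)); first by field.
  by rewrite dh; field.
(* Conjugation by the antidiagonal element w just obtained turns upper transvections into lower
   ones; as w^2 = -1, w^3 is its inverse. *)
have low s : GLmem H (mx2 1 0 s 1).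
  have := GLmemM (GLmemM Hw (up (- s / c ^+ 2))) (GLmemM Hw (GLmemM Hw Hw)).
  by rewrite !mul_mx2; congr (GLmem H); congr mx2; field.
(* The big Bruhat cell: a nonzero lower left entry allows a factorization upper, lower, upper. *)
have mem x y z t : z != 0 -> x * t - y * z = 1 -> GLmem H (mx2 x y z t).
  move=> z_nz dxt.
  have := GLmemM (GLmemM (up ((x - 1) / z)) (low z)) (up ((t - 1) / z)).
  rewrite !mul_mx2; congr (GLmem H); congr mx2; try by field.
  apply: (mulIf z_nz); transitivity (x * t - 1); first by field.
  by rewrite -dxt; ring.
apply/subsetP => u /SL2_det; rewrite (mx2_eta (GLmx u)) det_mx2.
move: (GLmx u 0 0) (GLmx u 0 1) (GLmx u 1 0) (GLmx u 1 1) (mx2_eta (GLmx u)).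
move=> x y z t Eu dxt.
suff [h Hh1 Eh] : GLmem H (mx2 x y z t).
  by have -> : u = h by apply: GLmx_inj; rewrite Eh.
have [z0|z_nz] := eqVneq z 0; last exact: mem.
have t_nz : t != 0.
  apply: contra_eqN dxt => /eqP->; rewrite z0 !mulr0 subr0 eq_sym; exact: oner_neq0.
(* An upper triangular matrix is an element of the big cell times a lower transvection. *)
have := GLmemM (mem (x + y) y t t t_nz _) (low (-1)).
rewrite mul_mx2 z0 !mulr1 !mulr0 !add0r !mulrN1 subrr addrK; apply.
by rewrite -dxt z0; ring.
Qed.

(** The rows of [P] are v and v (A - 1), where v is the first standard basis vector not fixed by
    [A]. *)
Lemma unipotent_mx2_conj (A : 'M['F_p]_2) : (A - 1) ^+ 2 = 0 -> A != 1 ->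
  exists2 P, \det P != 0 & P * A = mx2 1 1 0 1 * P.
Proof.
rewrite (mx2_eta A); move: (A 0 0) (A 0 1) (A 1 0) (A 1 1) => a b c d.
rewrite expr2 one_mx2 !mx2E zero_mx2 !subr0 => /mx2_inj[E1 E2 E3 E4] An1.
have [b0|b_nz] := eqVneq b 0; last first.
  exists (mx2 1 0 (a - 1) b); first by rewrite det_mx2 mul1r mul0r subr0.
  rewrite !mul_mx2; congr mx2; try by ring.
    by apply/eqP; rewrite -subr_eq0; apply/eqP; rewrite -[RHS]E1; ring.
  by apply/eqP; rewrite -subr_eq0; apply/eqP; rewrite -[RHS]E2; ring.
move: E1 E4; rewrite b0 mul0r mulr0 addr0 add0r => /eqP + /eqP.
rewrite -!expr2 !expf_eq0 !subr_eq0 /= => /eqP a1 /eqP d1.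
have c_nz : c != 0.
  by apply: contraNneq An1 => c0; rewrite a1 b0 c0 d1.
exists (mx2 0 1 c 0); first by rewrite det_mx2 mul0r mul1r sub0r oppr_eq0.
by rewrite a1 d1 !mul_mx2; congr mx2; ring.
Qed.

(** An element of order [p] is unipotent. Once it is conjugated to the standard transvection, one
    element that is not upper triangular suffices; without one, the second row of the conjugating
    matrix would be a common eigenvector. *)
Lemma irreducible_p_SL2 (H : {group {'GL_2(p)}}) :
    H \subset SL2 p -> (p %| #|H|)%N ->
    (forall v : 'rV['F_p]_2, v != 0 ->
       ~ forall h, h \in H -> exists c, v *m GLmx h = c *: v) ->
  H :=: SL2 p.
Proof.
move=> sHS pH irrH; have [u Hu ou] := Cauchy p_pr pH.
have up : GLmx u ^+ p = 1%:M 
  by rewrite -GLmxX (_ : u ^+ p = 1)%g //; apply/eqP; rewrite -order_dvdn ou.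
have un1 : GLmx u != 1.
  apply: contraL (prime_gt1 p_pr) => /eqP Eu.
  have u1 : u = 1%g by apply: GLmx_inj.
  by move: ou; rewrite u1 order1 => <-.
have [P dP EP] := unipotent_mx2_conj (mx2_expp_scalar p_pr up) un1.
pose g := GLof P; have Eg : GLmx g = P := GLofK dP.
have memg (h : {'GL_2(p)}) : GLmx (h ^ g^-1) * P = P * GLmx h.
  by rewrite -Eg -!GLmxM conjgE invgK !mulgA mulgKV.
have cardHg : #|(H :^ g^-1)%g| = #|H| by rewrite cardJg.
apply/eqP; rewrite eqEcard sHS -cardHg subset_leq_card //.
have H1 : GLmem (H :^ g^-1)%G (mx2 1 1 0 1).
  exists (u ^ g^-1)%g; first by rewrite memJ_conjg.
  have uP : P \in unitmx by rewrite unitmxE unitfE.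
  apply: (@mulIr _ P uP).
  by rewrite memg EP.
have [/existsP[h /andP[Hh h_nz]] | no] :=
  boolP [exists h, (h \in H) && (GLmx (h ^ g^-1) 1 0 != 0)].
  apply: (@SL2_sub_transvection _ _ (GLmx (h ^ g^-1) 0 1) _ (GLmx (h ^ g^-1) 1 1)
           H1 _ h_nz).
    by exists (h ^ g^-1)%g; [rewrite memJ_conjg | exact: mx2_eta].
  rewrite -det_mx2 -mx2_eta -(SL2_det (subsetP sHS h Hh)).
  apply: (mulIf dP); rewrite [RHS]mulrC -!det_mulmx.
  by congr (\det _); apply: memg.
case: (irrH (row 1 P)).
  apply: contraNneq dP => r0; rewrite (mx2_eta P) det_mx2.
  have Pj j : P 1 j = 0 by have := congr1 (fun v : 'rV__ => v 0 j) r0; rewrite !mxE.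
  by rewrite !Pj !mulr0 subrr.
move=> h Hh; exists (GLmx (h ^ g^-1) 1 1).
have E0 : GLmx (h ^ g^-1) 1 0 = 0.
  by apply/eqP; move/existsPn/(_ h): no; rewrite Hh /= negbK.
rewrite -row_mul -[P *m _]/(P * GLmx h) -memg.
move: (GLmx _) E0 => B E0; apply/rowP => j; rewrite !mxE big_ord_recl big_ord1 /=.
rewrite (_ : lift ord0 ord0 = 1); last exact: val_inj.
by rewrite E0 mul0r add0r.
Qed.

End Generation.

(** * The split quaternion algebra *)

Section Quaternions.

Variables (F : fieldType) (a b : F).
Local Open Scope ring_scope.
Hypotheses (ab : a ^+ 2 + b ^+ 2 = -1) (nz2 : 2 != 0 :> F).

(* The image of the quaternion [t + x i + y j + z ij] under [i |-> mx2 a b b (-a)]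
   and [j |-> mx2 0 1 (-1) 0]. *)
Definition quat (t x y z : F) : 'M[F]_2 :=
  mx2 (t + x * a - z * b) (x * b + y + z * a)
      (x * b - y + z * a) (t - x * a + z * b).

Lemma mul_quat t x y z t' x' y' z' : quat t x y z * quat t' x' y' z' =
  quat (t * t' - x * x' - y * y' - z * z') (t * x' + x * t' + y * z' - z * y')
       (t * y' + y * t' + z * x' - x * z') (t * z' + z * t' + x * y' - y * x').
Proof.
have key X Y E : X = Y + (a ^+ 2 + b ^+ 2 + 1) * E -> X = Y.
  by move->; rewrite ab addNr mul0r addr0.
rewrite /quat mul_mx2; congr mx2.
- by apply: (key _ _ (x * x' + z * z')); ring.
- by apply: (key _ _ (x * z' - z * x')); ring.
- by apply: (key _ _ (z * x' - x * z')); ring.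
- by apply: (key _ _ (x * x' + z * z')); ring.
Qed.

Lemma add_quat t x y z t' x' y' z' : quat t x y z + quat t' x' y' z' =
  quat (t + t') (x + x') (y + y') (z + z').
Proof. by rewrite /quat add_mx2; congr mx2; ring. Qed.

Lemma scale_quat c t x y z : c *: quat t x y z = quat (c * t) (c * x) (c * y) (c * z).
Proof. by rewrite /quat scale_mx2; congr mx2; ring. Qed.

Lemma opp_quat t x y z : - quat t x y z = quat (- t) (- x) (- y) (- z).
Proof. by rewrite -scaleN1r scale_quat !mulN1r. Qed.

Lemma scalar_quat t : t%:M = quat t 0 0 0.
Proof. by rewrite scalar_mx2; congr mx2; ring. Qed.

Definition quatE := (mul_quat, add_quat, opp_quat, scale_quat).

Lemma det_quat t x y z : \det (quat t x y z) = t ^+ 2 + x ^+ 2 + y ^+ 2 + z ^+ 2.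
Proof.
rewrite det_mx2; transitivity (t ^+ 2 + y ^+ 2 - (a ^+ 2 + b ^+ 2) * (x ^+ 2 + z ^+ 2)).
  by ring.
by rewrite ab; ring.
Qed.

Lemma mxtrace_quat t x y z : \tr (quat t x y z) = 2 * t.
Proof. by rewrite mxtrace_mx2; ring. Qed.

Lemma quat_inj t x y z t' x' y' z' : quat t x y z = quat t' x' y' z' ->
  [/\ t = t', x = x', y = y' & z = z'].
Proof.
case/mx2_inj => /eqP + /eqP + /eqP + /eqP.
rewrite -!(subr_eq0 _ (_ + _)) => /eqP E1 /eqP E2 /eqP E3 /eqP E4.
have zero (X : F) : 2 * X = 0 -> X = 0.
  by move=> X0; apply: (mulfI nz2); rewrite mulr0.
have Et : t - t' = 0.
  by apply: zero; have := congr2 +%R E1 E4; rewrite addr0 => <-; ring.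
have Ey : y - y' = 0.
  by apply: zero; have := congr2 (fun u v => u - v) E2 E3; rewrite /= subr0 => <-; ring.
have E5 : (x - x') * a - (z - z') * b = 0.
  by have := congr2 (fun u v => u - v) E1 Et; rewrite /= subr0 => <-; ring.
have E6 : (x - x') * b + (z - z') * a = 0.
  by have := congr2 (fun u v => u - v) E2 Ey; rewrite /= subr0 => <-; ring.
have Ex : (x - x') * (a ^+ 2 + b ^+ 2) = 0.
  transitivity (((x - x') * a - (z - z') * b) * a + ((x - x') * b + (z - z') * a) * b).
    by ring.
  by rewrite E5 E6 !mul0r addr0.
have Ez : (z - z') * (a ^+ 2 + b ^+ 2) = 0.
  transitivity (((x - x') * b + (z - z') * a) * a - ((x - x') * a - (z - z') * b) * b).
    by ring.
  by rewrite E5 E6 !mul0r subr0.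
move: Ex Ez => /eqP + /eqP; rewrite ab !mulrN1 !oppr_eq0 !subr_eq0 => /eqP-> /eqP->.
by move: Et Ey => /eqP + /eqP; rewrite !subr_eq0 => /eqP-> /eqP->.
Qed.

Lemma quat_scalar t x y z : is_scalar_mx (quat t x y z) -> [/\ x = 0, y = 0 & z = 0].
Proof.
by case/is_scalar_mxP => c; rewrite scalar_quat => /quat_inj[].
Qed.

(** The pure part has square -2, so it plays the role of sqrt (-2). *)
Lemma quat_exprn_lucas x y z n : x ^+ 2 + y ^+ 2 + z ^+ 2 = 2 ->
  quat 1 x y z ^+ n = quat (lucas n).1%:~R ((lucas n).2%:~R * x)
                           ((lucas n).2%:~R * y) ((lucas n).2%:~R * z).
Proof.
move=> norm2; elim: n => [|n IHn].
  by rewrite expr0 -[LHS]/(1%:M) scalar_quat /= !mul0r.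
rewrite exprS IHn mul_quat lucasS /= intrB intrD intrM.
congr quat; try by ring.
transitivity ((lucas n).1%:~R - (lucas n).2%:~R * (x ^+ 2 + y ^+ 2 + z ^+ 2)).
  by ring.
by rewrite norm2; ring.
Qed.

End Quaternions.

(** * Normalizers, joins and subgroups of index two *)

Lemma norm_gen_memJ (gT : finGroupType) (A : {set gT}) (x : gT) :
  {in A, forall y, y ^ x \in <<A>>} -> x \in 'N(<<A>>).
Proof.
move=> AxA; rewrite inE -genJ gen_subG.
by apply/subsetP => _ /imsetP[y Ay ->]; apply: AxA.
Qed.

Lemma dvdn_card_norm_join (gT : finGroupType) (H : {group gT}) (x : gT) q :
  prime q -> x \in 'N(H) -> (q %| #|H <*> <[x]>|)%N -> ~~ (q %| #[x])%N ->
  (q %| #|H|)%N.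
Proof.
move=> q_pr Nx; rewrite norm_joinEr ?cycle_subG // => qHx nqx.
have : (q %| #|H| * #|<[x]>|)%N by rewrite mul_cardG dvdn_mulr.
by rewrite Euclid_dvdM // -orderE (negPf nqx) orbF.
Qed.

Lemma sqr_mem_index_le2 (gT : finGroupType) (G A : {group gT}) g :
  A \subset G -> (#|G : A| <= 2)%N -> g \in G -> g ^+ 2 \in A.
Proof.
move=> sAG; rewrite leq_eqVlt ltnS => /orP[/eqP ind2 | ind1] Gg.
  have nAG := index2_normal sAG ind2; have Ng := subsetP (normal_norm nAG) g Gg.
  apply: coset_idr; first exact: groupX.
  by rewrite morphX // -ind2 -card_quotient ?normal_norm // expg_cardG // mem_quotient.
rewrite (index1g sAG); first exact: groupX.
by apply/eqP; rewrite eqn_leq ind1 indexg_gt0.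
Qed.

(** * The center of SL(2, p) and automorphisms of PSL(2, p) *)

Section ProjectiveSL2.

Variables (p : nat) (p_pr : prime p).
Implicit Types (u v g : {'GL_2(p)}).
Local Notation Zp := 'Z(SL2 p).

Lemma SL2_mem (A : 'M['F_p]_2) : (\det A = 1)%R -> GLof A \in SL2 p /\ GLmx (GLof A) = A.
Proof.
move=> dA; have E : GLmx (GLof A) = A by apply: GLofK; rewrite dA oner_neq0.
by split=> //; rewrite inE -[X in (\det X)%R]/(GLmx (GLof A)) E dA.
Qed.

(** Commuting with the two elementary transvections already forces a scalar matrix. *)
Lemma SL2_centerP u : u \in SL2 p -> (u \in Zp) = is_scalar_mx (GLmx u).
Proof.
move=> Su; apply/idP/idP => [/setIP[_ /centP cu] | sc_u]; last first.
  by rewrite inE Su; apply/centP => v _; apply: GLmx_scalar_commute.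
have d1 : (\det (mx2 1 1 0 1 : 'M['F_p]_2) = 1)%R by rewrite det_mx2; ring.
have [S1 E1] := SL2_mem d1.
have d2 : (\det (mx2 1 0 1 1 : 'M['F_p]_2) = 1)%R by rewrite det_mx2; ring.
have [S2 E2] := SL2_mem d2.
have /GLmx_commuteP := cu _ S1; have /GLmx_commuteP := cu _ S2.
rewrite E1 E2 (mx2_eta (GLmx u)) !mul_mx2 => /mx2_inj[+ _ _ _] /mx2_inj[+ + _ _].
move: (GLmx u 0 0)%R (GLmx u 0 1)%R (GLmx u 1 0)%R (GLmx u 1 1)%R => x y z t.
rewrite !(mulr1, mulr0, mul1r, mul0r, addr0, add0r) => E3 E4 E5.
have y0 : y = 0%R by apply: (addrI x); rewrite E3 addr0.
have z0 : z = 0%R by apply: (addrI x); rewrite -E4 addr0.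
have xt : x = t by apply: (addIr y); rewrite E5 addrC.
by rewrite y0 z0 xt -scalar_mx2 scalar_mx_is_scalar.
Qed.

(** The center consists of scalars. This makes [coset Zp] multiplicative on all of GL(2, p). *)
Lemma GL2_norm_center u : u \in 'N(Zp).
Proof.
apply: (subsetP (cents_norm _) u (set11 u)); rewrite sub1set.
apply/centP => z Zz; apply/commute_sym; apply: GLmx_scalar_commute.
by rewrite -SL2_centerP // (subsetP (center_sub _)).
Qed.

Lemma cosetZM u v : coset Zp (u * v) = coset Zp u * coset Zp v.
Proof. by rewrite morphM ?GL2_norm_center. Qed.

Lemma coset_oppmx u v : (GLmx u = - GLmx v)%R -> coset Zp u = coset Zp v.
Proof.
move=> E; have dN1 : (\det (-1%:M : 'M['F_p]_2) = 1)%R.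
  by rewrite -raddfN det_scalar sqrrN expr1n.
have [S1 E1] := SL2_mem dN1.
have -> : u = GLof (- 1%:M)%R * v.
  by apply: GLmx_inj; rewrite GLmxM E1 E mulNr mul1r.
by rewrite coset_kerl // SL2_centerP // E1 -raddfN scalar_mx_is_scalar.
Qed.

Lemma order_coset_scalar u n : prime n -> u \in SL2 p -> ~~ is_scalar_mx (GLmx u) ->
  is_scalar_mx (GLmx u ^+ n)%R -> #[coset Zp u] = n.
Proof.
move=> n_pr Su ns_u sc_un; apply: nt_prime_order => //.
  have <- : coset Zp (u ^+ n) = coset Zp u ^+ n by rewrite morphX ?GL2_norm_center.
  by rewrite coset_id // SL2_centerP ?groupX // GLmxX.
apply: contra ns_u => /eqP u1; rewrite -SL2_centerP //.
by apply: coset_idr; rewrite ?GL2_norm_center.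
Qed.

Lemma GL2_norm_SL2 u : u \in 'N(SL2 p).
Proof.
rewrite inE; apply/subsetP => _ /imsetP[v Sv ->].
have du : (\det (GLmx u) != 0)%R.
  have : GLmx u \in unitmx by exact: (valP u).
  by rewrite unitmxE unitfE.
have : (\det (GLmx u) * \det (GLmx (v ^ u)) = \det (GLmx v) * \det (GLmx u))%R.
  by rewrite -!det_mulmx; congr (\det _)%R; apply: GLmxJ.
rewrite (SL2_det Sv) mul1r -[RHS]mulr1 => /(mulfI du) E.
by rewrite inE; apply/eqP.
Qed.

(** GL(2, p) normalizes SL(2, p) and its center, hence acts on the quotient, where the sign
    disappears. *)
Lemma PSL2_conj_aut g : exists f : {perm coset_of Zp}, f \in Aut (PSL2 p) /\
  {in SL2 p &, forall u v,
     (GLmx u * GLmx g = GLmx g * GLmx v \/ GLmx u * GLmx g = - (GLmx g * GLmx v))%R ->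
     f (coset Zp u) = coset Zp v}.
Proof.
have Ng : coset Zp g \in 'N(PSL2 p).
  have : coset Zp g \in 'N(SL2 p) / Zp by rewrite mem_quotient ?GL2_norm_SL2.
  by apply: subsetP; apply: quotient_norms.
exists (conj_aut (PSL2_group p) (coset Zp g)); split.
  by rewrite (subsetP (Aut_conj_aut _ 'N(PSL2 p))) // mem_morphim.
move=> u v Su Sv E; rewrite norm_conj_autE ?mem_quotient //.
apply: (mulgI (coset Zp g)); rewrite -conjgC -!cosetZM.
case: E => E; last exact: coset_oppmx.
by congr (coset _ _); apply: GLmx_inj.
Qed.

End ProjectiveSL2.

(** * Identities between the quaternions defining the map *)

Section QuaternionIdentities.

Variables (F : fieldType) (a b r : F).
Local Open Scope ring_scope.
Hypotheses (ab : a ^+ 2 + b ^+ 2 = -1) (nz2 : 2 != 0 :> F) (r3 : 3 * r ^+ 2 = 1).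

Definition qi := quat a b 0 1 0 0.
Definition qj := quat a b 0 0 1 0.
Definition qz := quat a b 0 r r r.
(** A Hurwitz unit with cube -1; conjugation by it permutes i, ij, j cyclically and fixes [qz]. *)
Definition qc := quat a b (2^-1) (2^-1) (2^-1) (2^-1).

(* Conjugation by these elements realizes the duality and the Petrie duality. *)
Definition qdual := quat a b 0 1 (-1) 0.
Definition qpetrie := quat a b 0 1 0 (-1).

Let nzr : r != 0.
Proof.
by apply/eqP => r0; move: r3; rewrite r0 expr0n mulr0 => /eqP; rewrite eq_sym oner_eq0.
Qed.

Lemma quat_neg1 : quat a b (-1) 0 0 0 = -1.
Proof. by rewrite -scalar_quat raddfN. Qed.

Lemma qiqi : qi * qi = -1.
Proof. by rewrite -quat_neg1 mul_quat //; congr quat; ring. Qed.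

Lemma qjqj : qj * qj = -1.
Proof. by rewrite -quat_neg1 mul_quat //; congr quat; ring. Qed.

Lemma qzqz : qz * qz = -1.
Proof.
rewrite -quat_neg1 mul_quat //; congr quat; try ring.
by transitivity (- (3 * r ^+ 2)); [ring | rewrite r3].
Qed.

Lemma qc3 : qc ^+ 3 = -1.
Proof.
by rewrite -quat_neg1 !exprS expr0 mulr1 !mul_quat //; congr quat; field.
Qed.

Lemma qiqj : qi * qj = - (qj * qi).
Proof. by rewrite !quatE //; congr quat; ring. Qed.

Lemma qjqz : qj * qz = quat a b (- r) r 0 (- r).
Proof. by rewrite mul_quat //; congr quat; ring. Qed.

Lemma qzqi : qz * qi = quat a b (- r) 0 r (- r).
Proof. by rewrite mul_quat //; congr quat; ring. Qed.

Lemma qiqc : qi * qc = qc * (qi * qj).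
Proof. by rewrite !mul_quat //; congr quat; ring. Qed.

Lemma qjqc : qj * qc = qc * qi.
Proof. by rewrite !mul_quat //; congr quat; ring. Qed.

Lemma qzqc : qz * qc = qc * qz.
Proof. by rewrite !mul_quat //; congr quat; ring. Qed.

Lemma det_qi : \det qi = 1. Proof. by rewrite det_quat //; ring. Qed.
Lemma det_qj : \det qj = 1. Proof. by rewrite det_quat //; ring. Qed.
Lemma det_qz : \det qz = 1. Proof. by rewrite det_quat // -[RHS]r3; ring. Qed.
Lemma det_qc : \det qc = 1. Proof. by rewrite det_quat //; field. Qed.

Lemma det_qdual : \det qdual != 0.
Proof. by rewrite det_quat // (_ : _ + _ = 2) //; ring. Qed.

Lemma det_qpetrie : \det qpetrie != 0.
Proof. by rewrite det_quat // (_ : _ + _ = 2) //; ring. Qed.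

Lemma qi_qdual : qi * qdual = - (qdual * qj).
Proof. by rewrite !quatE //; congr quat; ring. Qed.
Lemma qj_qdual : qj * qdual = - (qdual * qi).
Proof. by rewrite !quatE //; congr quat; ring. Qed.
Lemma qz_qdual : qz * qdual = - (qdual * qz).
Proof. by rewrite !quatE //; congr quat; ring. Qed.

Lemma qi_qpetrie : qi * qpetrie = - (qpetrie * (qi * qj)).
Proof. by rewrite !quatE //; congr quat; ring. Qed.
Lemma qiqj_qpetrie : qi * qj * qpetrie = - (qpetrie * qi).
Proof. by rewrite !quatE //; congr quat; ring. Qed.
Lemma qj_qpetrie : qj * qpetrie = - (qpetrie * qj).
Proof. by rewrite !quatE //; congr quat; ring. Qed.
Lemma qz_qpetrie : qz * qpetrie = - (qpetrie * qz).
Proof. by rewrite !quatE //; congr quat; ring. Qed.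

Lemma qi_nonscalar : ~~ is_scalar_mx qi.
Proof. by apply/negP => /quat_scalar[] // /eqP; rewrite oner_eq0. Qed.
Lemma qj_nonscalar : ~~ is_scalar_mx qj.
Proof. by apply/negP => /quat_scalar[] // _ /eqP; rewrite oner_eq0. Qed.
Lemma qz_nonscalar : ~~ is_scalar_mx qz.
Proof. by apply/negP => /quat_scalar[] // /eqP; rewrite (negPf nzr). Qed.
Lemma qjqz_nonscalar : ~~ is_scalar_mx (qj * qz).
Proof. by rewrite qjqz; apply/negP => /quat_scalar[] // /eqP; rewrite (negPf nzr). Qed.
Lemma qzqi_nonscalar : ~~ is_scalar_mx (qz * qi).
Proof. by rewrite qzqi; apply/negP => /quat_scalar[] // _ /eqP; rewrite (negPf nzr). Qed.

Lemma qz_qi_noncomm : qz * qi <> qi * qz.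
Proof.
rewrite !mul_quat // => /quat_inj[] // _ _ /eqP; rewrite -subr_eq0 (_ : _ - _ = 2 * r).
  by rewrite mulf_eq0 (negPf nz2) (negPf nzr).
by ring.
Qed.

Lemma qc_qi_noncomm : qc * qi <> qi * qc.
Proof.
rewrite !mul_quat // => /quat_inj[] // _ _ /eqP; rewrite -subr_eq0 (_ : _ - _ = 1).
  by rewrite oner_eq0.
by field.
Qed.

Lemma qjqz2_qc_noncomm : (qj * qz) * (qj * qz) * qc <> qc * ((qj * qz) * (qj * qz)).
Proof.
rewrite qjqz !mul_quat // => /quat_inj[] // _ /eqP.
rewrite -subr_eq0 (_ : _ - _ = - (2 * r ^+ 2)).
  by rewrite oppr_eq0 mulf_eq0 (negPf nz2) expf_eq0 (negPf nzr).
by field.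
Qed.

(** A common eigenvector of the two products would be killed by their commutator, so this gives
    irreducibility. *)
Lemma det_qjqz_qzqi_comm : \det ((qj * qz) * (qz * qi) - (qz * qi) * (qj * qz)) != 0.
Proof.
rewrite qjqz qzqi !quatE // det_quat //.
rewrite (_ : _ + _ = (2 * r) ^+ 2 * (3 * r ^+ 2)); last by ring.
by rewrite r3 mulr1 expf_eq0 mulf_eq0 (negPf nz2) (negPf nzr).
Qed.

Lemma qjqz_exprn_scalar n : (lucas n).2%:~R = 0 :> F -> is_scalar_mx ((qj * qz) ^+ n).
Proof.
(* Up to the scalar -r this is 1 + w with w = -i + ij, and w^2 = -2. *)
move=> U0; rewrite qjqz (_ : quat _ _ _ _ _ _ = - r *: quat a b 1 (-1) 0 1).
  rewrite exprZn quat_exprn_lucas //; last by ring.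
  by rewrite U0 !mul0r -scalar_quat scale_scalar_mx scalar_mx_is_scalar.
by rewrite scale_quat; congr quat; ring.
Qed.

Lemma qzqi_exprn_scalar n : (lucas n).2%:~R = 0 :> F -> is_scalar_mx ((qz * qi) ^+ n).
Proof.
move=> U0; rewrite qzqi (_ : quat _ _ _ _ _ _ = - r *: quat a b 1 0 (-1) 1).
  rewrite exprZn quat_exprn_lucas //; last by ring.
  by rewrite U0 !mul0r -scalar_quat scale_scalar_mx scalar_mx_is_scalar.
by rewrite scale_quat; congr quat; ring.
Qed.

Lemma qjqz_trace : \tr (qj * qz) ^+ 2 = 4 * r ^+ 2.
Proof. by rewrite qjqz mxtrace_quat; ring. Qed.

End QuaternionIdentities.

(** * Consequences of the quaternion relations *)

(* Abstract form of the relations between the lifts of the generators of the map,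
   [n] being the central involution and [c] a lift of the triality
   that permutes [i], [ij], [j] cyclically up to sign. *)
Section QuaternionRelations.

Variables (gT : finGroupType) (n i j z c : gT).
Hypotheses (n_comm : forall u, commute n u) (nn : n * n = 1).
Hypotheses (ii : i * i = n) (jj : j * j = n) (zz : z * z = n) (ccc : c ^+ 3 = n).
Hypotheses (ij : i * j = n * (j * i)).
Hypotheses (ic : i * c = c * (i * j)) (jc : j * c = c * i) (zc : z * c = c * z).

Local Notation H := <<[set n; j * z; z * i]>>.
Local Notation L := <<[set i; j; z]>>.
Local Notation K := <<[set i; j; z; c]>>.

Let conj_eq (u v h : gT) : u * h = h * v -> u ^ h = v.
Proof. by move=> E; rewrite conjgE E mulKg. Qed.

Let c_norm_L : c \in 'N(L).
Proof.
have [Li Lj Lz] : [/\ i \in L, j \in L & z \in L].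
  by split; rewrite mem_gen // !inE eqxx ?orbT.
apply: norm_gen_memJ => u; rewrite !inE -orbA => /or3P[] /eqP->.
- by rewrite (conj_eq ic) groupM.
- by rewrite (conj_eq jc).
- by rewrite (conj_eq zc).
Qed.

Let j_norm_H : j \in 'N(H).
Proof.
have [Hn Hjz Hzi] : [/\ n \in H, j * z \in H & z * i \in H].
  by split; rewrite mem_gen // !inE eqxx ?orbT.
apply: norm_gen_memJ => u; rewrite !inE -orbA => /or3P[] /eqP->.
- by rewrite (conj_eq (n_comm j)).
- rewrite (_ : (j * z) ^ j = (j * z)^-1) ?groupV //.
  apply: (mulgI (j * z)); rewrite mulgV conjgE !mulgA mulgKV.
  by rewrite -(mulgA j z z) zz -n_comm -mulgA jj nn.
- rewrite (_ : (z * i) ^ j = n * ((j * z) * ((j * z) * (z * i)))).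
    exact: groupM Hn (groupM Hjz (groupM Hjz Hzi)).
  apply: conj_eq.
  rewrite -(mulgA z) ij (mulgA z) -n_comm !mulgA -n_comm -(mulgA n j j) jj nn mul1g.
  by rewrite -(mulgA _ z z) zz -(n_comm (z * j)) !mulgA.
Qed.

(** [K] lies in [L <*> <[c]>], where [c] normalizes [L] and has order dividing 6; [L] lies in [H <*>
    <[j]>], where [j] normalizes [H] and has order dividing 4. A prime above 3 thus passes from |K|
    to |H|. *)
Lemma dvdn_card_rotations q : prime q -> 3 < q -> q %| #|K| -> q %| #|H|.
Proof.
move=> q_pr q_gt3 qK.
have ndvd (u : gT) m : u ^+ m = 1 -> m = 4 \/ m = 6 -> ~~ (q %| #[u]).
  move=> um m_val; apply/negP => q_u.
  have q_m : q %| m by apply: dvdn_trans q_u _; rewrite order_dvdn um.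
  case: m_val => Em; move: q_m; rewrite Em.
    by rewrite (_ : 4 = 2 * 2)%N // Euclid_dvdM // => /orP[] /dvdn_leq; lia.
  by rewrite (_ : 6 = 2 * 3)%N // Euclid_dvdM // => /orP[] /dvdn_leq; lia.
have j4 : j ^+ 4 = 1 by rewrite (expgM _ 2 2) !expg2 jj nn.
have c6 : c ^+ 6 = 1 by rewrite (expgM _ 3 2) ccc expg2 nn.
have qL : q %| #|L|.
  apply: (dvdn_card_norm_join q_pr c_norm_L); last by apply: (ndvd _ _ c6); right.
  apply: dvdn_trans qK (cardSg _); rewrite gen_subG !subUset !sub1set.
  have sLJ u : u \in [set i; j; z] -> u \in L <*> <[c]>.
    by move=> Su; rewrite (subsetP (joing_subl _ _)) ?mem_gen.
  have -> : c \in L <*> <[c]> by rewrite (subsetP (joing_subr _ _)) ?cycle_id.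
  by rewrite !sLJ ?inE ?eqxx ?orbT.
apply: (dvdn_card_norm_join q_pr j_norm_H); last by apply: (ndvd _ _ j4); left.
apply: dvdn_trans qL (cardSg _).
have sHJ u : u \in [set n; j * z; z * i] -> u \in H <*> <[j]>.
  by move=> Su; rewrite (subsetP (joing_subl _ _)) ?mem_gen.
have [Jn Jjz Jzi] : [/\ n \in H <*> <[j]>, j * z \in H <*> <[j]>
                      & z * i \in H <*> <[j]>].
  by split; rewrite sHJ // !inE eqxx ?orbT.
have Jj : j \in H <*> <[j]> by rewrite (subsetP (joing_subr _ _)) ?cycle_id.
have Jz : z \in H <*> <[j]>.
  have := groupM Jn (groupM Jj Jjz).
  by rewrite (mulgA j) jj mulgA nn mul1g.
have Ji : i \in H <*> <[j]>.
  have := groupM Jn (groupM Jz Jzi).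
  by rewrite (mulgA z) zz mulgA nn mul1g.
by rewrite gen_subG !subUset !sub1set Ji Jj Jz.
Qed.

(** Modulo the center, [z] and [c] have orders 2 and 3 in the centralizer of [c]: neither commutes
    with [i], while z^2 = c^3 = n is central. *)
Lemma card_cent1_triality : c * i <> i * c -> z * i <> i * z ->
  (c \in K :\: 'Z(K)) && (6 * #|'Z(K)| <= #|'C_K[c]|)%N.
Proof.
move=> ci zi.
have [Ki Kz Kc] : [/\ i \in K, z \in K & c \in K].
  by split; rewrite mem_gen // !inE eqxx ?orbT.
have ncZ : c \notin 'Z(K) by apply/negP => /setIP[_ /centP/(_ i Ki)].
have nzZ : z \notin 'Z(K) by apply/negP => /setIP[_ /centP/(_ i Ki)].
have Zn : n \in 'Z(K).
  by rewrite inE -{1}ii groupM //=; apply/centP => u _; apply: n_comm.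
have sZC : 'Z(K) \subset 'C_K[c].
  rewrite subsetI subsetIl /=; apply/subsetP => u /setIP[_ /centP Cu].
  exact/cent1P/Cu.
have nZC : 'C_K[c] \subset 'N('Z(K)).
  exact: subset_trans (subsetIl _ _) (gFnorm _ _).
have Cc : c \in 'C_K[c] by rewrite inE Kc cent1id.
have Cz : z \in 'C_K[c] by rewrite inE Kz; apply/cent1P.
have dvd_order u m : prime m -> u \in 'C_K[c] -> u \notin 'Z(K) -> u ^+ m = n ->
    m %| #|'C_K[c] : 'Z(K)|.
  move=> m_pr Cu nZu um; have Nu := subsetP nZC u Cu.
  rewrite -card_quotient // -(@nt_prime_order _ m (coset 'Z(K) u)) //.
  - by apply: order_dvdG; rewrite mem_quotient.
  - have <- : coset 'Z(K) (u ^+ m) = coset 'Z(K) u ^+ m by rewrite morphX.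
    by rewrite coset_id // um.
  - by apply: contra nZu => /eqP; apply: coset_idr.
have ind6 : (6 <= #|'C_K[c] : 'Z(K)|)%N.
  apply: dvdn_leq; first exact: indexg_gt0.
  by rewrite (@Gauss_dvd 2 3) // (dvd_order z) ?(dvd_order c) ?expg2.
rewrite inE ncZ Kc /= -(Lagrange sZC) mulnC.
by rewrite leq_pmul2l ?cardG_gt0.
Qed.

End QuaternionRelations.

(** * The lifted rotations generate SL(2, p) *)

Section QuaternionMap.

Variables (p : nat) (p_pr : prime p) (p_gt3 : 3 < p) (a b r : 'F_p).
Hypotheses (ab : (a ^+ 2 + b ^+ 2 = -1)%R) (r3 : (3 * r ^+ 2 = 1)%R).

Let nz2 : (2 != 0 :> 'F_p)%R.
Proof. by rewrite Fp_natr_eq0 // gtnNdvd // ltnW. Qed.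

Variables n1 gi gj gz gc : {'GL_2(p)}.
Hypotheses (n1E : GLmx n1 = (-1)%R) (iE : GLmx gi = qi a b) (jE : GLmx gj = qj a b)
  (zE : GLmx gz = qz a b r) (cE : GLmx gc = qc a b).

Lemma GLmx_SL2 (u : {'GL_2(p)}) A : GLmx u = A -> (\det A = 1)%R -> u \in SL2 p.
Proof. by move=> <- dA; rewrite inE; apply/eqP. Qed.

Let Sn1 : n1 \in SL2 p.
Proof.
by apply: (GLmx_SL2 n1E); rewrite -[1%R]/(1%:M)%R -raddfN det_scalar sqrrN expr1n.
Qed.
Let Si : gi \in SL2 p. Proof. exact: GLmx_SL2 iE (det_qi ab). Qed.
Let Sj : gj \in SL2 p. Proof. exact: GLmx_SL2 jE (det_qj ab). Qed.
Let Sz : gz \in SL2 p. Proof. exact: GLmx_SL2 zE (det_qz ab r3). Qed.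
Let Sc : gc \in SL2 p. Proof. exact: GLmx_SL2 cE (det_qc ab nz2). Qed.

Lemma SL2M (u v : {'GL_2(p)}) : u \in SL2 p -> v \in SL2 p -> u * v \in SL2 p.
Proof. exact: groupM. Qed.

Let n1_comm u : commute n1 u.
Proof. by apply/GLmx_commuteP; rewrite n1E mulN1r mulrN1. Qed.

Let n1n1 : n1 * n1 = 1.
Proof. by apply: GLmx_inj; rewrite GLmxM n1E mulN1r opprK. Qed.
Let ii : gi * gi = n1.
Proof. by apply: GLmx_inj; rewrite GLmxM n1E iE qiqi. Qed.
Let jj : gj * gj = n1.
Proof. by apply: GLmx_inj; rewrite GLmxM n1E jE qjqj. Qed.
Let zz : gz * gz = n1.
Proof. by apply: GLmx_inj; rewrite GLmxM n1E zE qzqz. Qed.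
Let ccc : gc ^+ 3 = n1.
Proof. by apply: GLmx_inj; rewrite GLmxX n1E cE qc3. Qed.
Let ij : gi * gj = n1 * (gj * gi).
Proof. by apply: GLmx_inj; rewrite !GLmxM n1E jE iE mulN1r qiqj. Qed.
Let ic : gi * gc = gc * (gi * gj).
Proof. by apply: GLmx_inj; rewrite !GLmxM cE jE iE qiqc. Qed.
Let jc : gj * gc = gc * gi.
Proof. by apply: GLmx_inj; rewrite !GLmxM cE jE iE qjqc. Qed.
Let zc : gz * gc = gc * gz.
Proof. by apply: GLmx_inj; rewrite !GLmxM cE zE qzqc. Qed.

(** Otherwise the centralizer of [gc] has index at most 2, so it contains the square of [gj * gz],
    which does not commute with [gc]. *)
Let dvd_card_K : p %| #|<<[set gi; gj; gz; gc]>>|.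
Proof.
apply/negPn/negP => p'K.
have ci : gc * gi <> gi * gc.
  by move/GLmx_commuteP; rewrite cE iE; apply: qc_qi_noncomm.
have zi : gz * gi <> gi * gz.
  by move/GLmx_commuteP; rewrite zE iE; apply: qz_qi_noncomm.
have /andP[ncZ big] := card_cent1_triality gj n1_comm ii zz ccc zc ci zi.
have K_sub : <<[set gi; gj; gz; gc]>> \subset SL2 p.
  by rewrite gen_subG !subUset !sub1set Si Sj Sz Sc.
have ind2 := pprime_index_cent1 p_pr (ltnW p_gt3) K_sub p'K ncZ big.
have Kj : gj \in <<[set gi; gj; gz; gc]>> by rewrite mem_gen // !inE eqxx ?orbT.
have Kz : gz \in <<[set gi; gj; gz; gc]>> by rewrite mem_gen // !inE eqxx ?orbT.
have := sqr_mem_index_le2 (subsetIl _ _) ind2 (groupM Kj Kz).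
case/setIP=> _ /cent1P/GLmx_commuteP.
by rewrite expg2 !GLmxM jE zE cE; apply: qjqz2_qc_noncomm.
Qed.

Lemma quat_rotations_SL2 : <<[set n1; gj * gz; gz * gi]>> = SL2 p.
Proof.
apply: (@irreducible_p_SL2 _ p_pr (generated_group _)).
- by rewrite gen_subG !subUset !sub1set Sn1 !SL2M.
- exact: (dvdn_card_rotations n1_comm n1n1 jj zz ccc ij ic jc zc p_pr p_gt3 dvd_card_K).
move=> v v_nz eig_v.
have [|c1 E1] := eig_v (gj * gz); first by rewrite mem_gen // !inE eqxx ?orbT.
have [|c2 E2] := eig_v (gz * gi); first by rewrite mem_gen // !inE eqxx ?orbT.
have := det_qjqz_qzqi_comm ab nz2 r3; apply/negP; rewrite negbK; apply/det0P.
exists v => //; move: E1 E2; rewrite !GLmxM jE zE iE.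
move: (qj a b * qz a b r)%R (qz a b r * qi a b)%R => A B E1 E2.
rewrite mulmxBr; apply/eqP; rewrite subr_eq0; apply/eqP.
rewrite -[(A * B)%R]/(A *m B)%R -[(B * A)%R]/(B *m A)%R !mulmxA E1 E2 -!scalemxAl E1 E2.
by rewrite !scalerA mulrC.
Qed.

End QuaternionMap.

(** * The regular map and its dualities *)

Section RegularMap.

Variables (p : nat) (p_pr : prime p) (p_gt3 : 3 < p) (a b r : 'F_p).
Hypotheses (ab : (a ^+ 2 + b ^+ 2 = -1)%R) (r3 : (3 * r ^+ 2 = 1)%R).
Variables (k : nat) (k_pr : prime k) (k_ge3 : 3 <= k).
Hypothesis lucas_k : ((lucas k).2%:~R = 0 :> 'F_p)%R.

Let nz2 : (2 != 0 :> 'F_p)%R.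
Proof. by rewrite Fp_natr_eq0 // gtnNdvd // ltnW. Qed.

Variables gi gj gz : {'GL_2(p)}.
Hypotheses (iE : GLmx gi = qi a b) (jE : GLmx gj = qj a b) (zE : GLmx gz = qz a b r).

Let Si : gi \in SL2 p. Proof. exact: GLmx_SL2 iE (det_qi ab). Qed.
Let Sj : gj \in SL2 p. Proof. exact: GLmx_SL2 jE (det_qj ab). Qed.
Let Sz : gz \in SL2 p. Proof. exact: GLmx_SL2 zE (det_qz ab r3). Qed.

Let x := coset 'Z(SL2 p) gi.
Let y := coset 'Z(SL2 p) gj.
Let z := coset 'Z(SL2 p) gz.

Let scalarN1 : is_scalar_mx (-1 : 'M['F_p]_2)%R.
Proof. by rewrite -[1%R]/(1%:M)%R -raddfN scalar_mx_is_scalar. Qed.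

Let order_x : #[x] = 2.
Proof.
by apply: order_coset_scalar; rewrite // iE ?expr2 ?qiqi ?qi_nonscalar.
Qed.
Let order_y : #[y] = 2.
Proof.
by apply: order_coset_scalar; rewrite // jE ?expr2 ?qjqj ?qj_nonscalar.
Qed.
Let order_z : #[z] = 2.
Proof.
by apply: order_coset_scalar; rewrite // zE ?expr2 ?qzqz ?qz_nonscalar.
Qed.
Let order_yz : #[y * z] = k.
Proof.
rewrite -cosetZM; apply: order_coset_scalar => //; first exact: SL2M.
  by rewrite GLmxM jE zE qjqz_nonscalar.
by rewrite GLmxM jE zE qjqz_exprn_scalar.
Qed.
Let order_zx : #[z * x] = k.
Proof.
rewrite -cosetZM; apply: order_coset_scalar => //; first exact: SL2M.
  by rewrite GLmxM iE zE qzqi_nonscalar.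
by rewrite GLmxM iE zE qzqi_exprn_scalar.
Qed.

Let comm_xy : commute x y.
Proof.
by rewrite /commute -!cosetZM; apply: coset_oppmx; rewrite !GLmxM iE jE qiqj.
Qed.

Let rotations : <<[set y * z; z * x]>> = PSL2 p.
Proof.
have dN1 : (\det (-1 : 'M['F_p]_2) = 1)%R.
  by rewrite -[1%R]/(1%:M)%R -raddfN det_scalar sqrrN expr1n.
have [_ n1E] := SL2_mem dN1; have [_ cE] := SL2_mem (det_qc ab nz2).
apply/eqP; rewrite eqEsubset; apply/andP; split.
  by rewrite gen_subG subUset !sub1set -!cosetZM !mem_quotient // SL2M.
have nS : SL2 p \subset 'N('Z(SL2 p)) by apply/subsetP => u _; apply: GL2_norm_center.
rewrite /PSL2 (sub_quotient_pre _ nS).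
rewrite -{1}(quat_rotations_SL2 p_pr p_gt3 ab r3 n1E iE jE zE cE) gen_subG.
rewrite !subUset !sub1set.
have inpre u : coset 'Z(SL2 p) u \in <<[set y * z; z * x]>> ->
    u \in coset 'Z(SL2 p) @*^-1 <<[set y * z; z * x]>>.
  by move=> Ru; rewrite mem_morphpre ?GL2_norm_center.
(* The generator -1 becomes trivial modulo the center, leaving the two rotations. *)
have Rn1 : coset 'Z(SL2 p) (GLof (-1)%R) \in <<[set y * z; z * x]>>.
  by rewrite (@coset_oppmx _ _ 1) ?n1E // morph1 group1.
by rewrite !inpre // cosetZM mem_gen // !inE eqxx ?orbT.
Qed.

Let generated : <<[set x; y; z]>> = PSL2_group p.
Proof.
have [Gx Gy Gz] : [/\ x \in <<[set x; y; z]>>, y \in <<[set x; y; z]>>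
                    & z \in <<[set x; y; z]>>].
  by split; rewrite mem_gen // !inE eqxx ?orbT.
apply/eqP; rewrite eqEsubset; apply/andP; split.
  by rewrite gen_subG !subUset !sub1set !mem_quotient.
by rewrite /= -rotations gen_subG subUset !sub1set !groupM.
Qed.

Definition quat_map : regular_map.
Proof.
refine (@RegularMap _ (PSL2_group p) x y z order_x order_y order_z comm_xy generated _ _).
  by rewrite order_yz.
by rewrite order_zx.
Defined.

Lemma quat_map_self_dual : self_dual quat_map.
Proof.
have dualE := GLofK (det_qdual ab nz2).
have [f [Af fE]] := PSL2_conj_aut (GLof (qdual a b)).
exists f; split=> //; apply: fE => //; right; rewrite dualE.
- by rewrite iE jE qi_qdual.
- by rewrite iE jE qj_qdual.
- by rewrite zE qz_qdual.
Qed.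

Lemma quat_map_self_Petrie_dual : self_Petrie_dual quat_map.
Proof.
have petrieE := GLofK (det_qpetrie ab nz2).
have [f [Af fE]] := PSL2_conj_aut (GLof (qpetrie a b)).
have Sij := SL2M Si Sj.
exists f; split=> //=; rewrite -?cosetZM; apply: fE => //; right; rewrite petrieE.
- by rewrite GLmxM iE jE qi_qpetrie.
- by rewrite GLmxM iE jE qiqj_qpetrie.
- by rewrite jE qj_qpetrie.
- by rewrite zE qz_qpetrie.
Qed.

Lemma quat_map_spec :
  [/\ map_aut quat_map \isog PSL2 p, nonorientable quat_map, valency quat_map = k,
      self_dual quat_map & self_Petrie_dual quat_map].
Proof.
split; [exact: isog_refl | exact: rotations | exact: order_yz | | ].
  exact: quat_map_self_dual.
exact: quat_map_self_Petrie_dual.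
Qed.

(** If k = p, the p-th power of [qj * qz] is scalar, so its squared trace 4 r^2 equals 4. Then r^2 =
    1 contradicts 3 r^2 = 1 in odd characteristic. *)
Let neq_kp : k != p.
Proof.
apply/eqP => kp; have /is_scalar_mxP[c Ec] := qjqz_exprn_scalar r ab lucas_k.
move: Ec; rewrite kp => /(mx2_expp_scalar_trace p_pr).
rewrite det_mulmx det_qj // det_qz // mulr1 mulr1 qjqz_trace // => E.
have nz4 : (4 != 0 :> 'F_p)%R by rewrite (_ : 4 = 2 * 2)%R ?mulf_neq0 // -natrM.
have r1 : (r ^+ 2 = 1)%R by apply: (mulfI nz4); rewrite mulr1.
move: r3; rewrite r1 mulr1 => /eqP; rewrite -subr_eq0.
by rewrite -(natrB _ (isT : 1 <= 3)%N) (negPf nz2).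
Qed.

(** The order [k] of [y * z] divides |GL(2, p)| = p (p - 1)^2 (p + 1), and [k] differs from [p]. *)
Lemma quat_map_congruence : (k %| p.-1)%N || (k %| p.+1)%N.
Proof.
have : k %| #|'GL_2(p)|.
  apply: dvdn_trans (cardSg (subsetT (SL2_group p))).
  rewrite -order_yz; apply: dvdn_trans (dvdn_quotient _ 'Z(SL2 p)).
  by apply: order_dvdG; rewrite -cosetZM mem_quotient // SL2M.
rewrite card_GL_2 card_Fp // !Euclid_dvdM // dvdn_prime2 //.
by rewrite (negPf neq_kp) orbb.
Qed.

End RegularMap.

(** * Choice of the prime p *)

Lemma congruent_pm1_dvdn p m : (m %| p.-1)%N || (m %| p.+1)%N -> 0 < p ->
  congruent_pm1 p m.
Proof.
move=> dv p_gt0; case/orP: dv => dv; [left | right]; apply/eqP.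
  rewrite eqz_mod_dvd (_ : p%:Z - 1 = p.-1%:Z)%R ?dvdzE //; lia.
by rewrite eqz_mod_dvd (_ : p%:Z - (-1) = p.+1%:Z)%R ?dvdzE //; lia.
Qed.

Theorem theorem4p1 (k : nat) (k_prime : prime k) (k_odd : odd k) (k_ge5 : 5 <= k) :
  exists p : nat,
    [/\ prime p, congruent_pm1 p (2 * k)%N, congruent_pm1 p 12 &
        exists M : regular_map,
          [/\ map_aut M \isog PSL2 p, nonorientable M, valency M = k,
              self_dual M & self_Petrie_dual M]].
Proof.
have [v [u Ek]] := lucas_odd_mod4 k_odd.
have U_neq1 := lucas_odd_neq1 k_odd k_ge5.
pose m := `|(lucas k).2|%N; pose p := pdiv m.
(* U = 1 modulo 4 and U distinct from 1 give |U| > 1, so a prime factor exists. *)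
have p_pr : prime p by apply: pdiv_prime; move: U_neq1; rewrite /m Ek /=; lia.
have p_U : (p%:Z %| (lucas k).2)%Z by rewrite dvdzE; apply: pdiv_dvd.
exists p.
have p_gt3 : 3 < p.
  have p_n2 : p <> 2 by move=> p2; move: p_U; rewrite p2 Ek /= => /dvdzP[q]; lia.
  have p_n3 : p <> 3.
    move=> p3; move: p_U; rewrite p3.
    have [w] := lucas_mod3 k.-1; rewrite prednK ?prime_gt0 // => Ew /dvdzP[q].
    by case: Ew => ->; lia.
  by have := prime_gt1 p_pr; lia.
have U0 : ((lucas k).2%:~R = 0 :> 'F_p)%R.
  have /dvdzP[q ->] := p_U.
  rewrite intrM (_ : p%:Z%:~R = p%:R :> 'F_p)%R //.
  by apply/eqP; rewrite mulf_eq0 Fp_natr_eq0 // dvdnn orbT.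
have nz3 : (3 != 0 :> 'F_p)%R by rewrite Fp_natr_eq0 // gtnNdvd.
have V3 : ((lucas k).1%:~R ^+ 2 = 3 ^+ k :> 'F_p)%R.
  have := congr1 (fun n : int => n%:~R : 'F_p)%R (lucas_norm k).
  by rewrite /= intrD intrM !rmorphXn /= U0 expr0n mulr0 addr0.
(* Since V^2 = 3^k with k odd, dividing V by 3^((k - 1)/2) gives a square root of 3. *)
pose s : 'F_p := ((lucas k).1%:~R / 3 ^+ k./2)%R.
have s2 : (s ^+ 2 = 3)%R.
  rewrite expr_div_n V3 -exprM muln2 -{1}(odd_double_half k) k_odd exprD expr1.
  by rewrite mulfK // expf_neq0.
have s_nz : s != 0%R by apply: contraNneq nz3 => s0; rewrite -s2 s0 expr0n.
have r3 : (3 * s^-1 ^+ 2 = 1 :> 'F_p)%R by rewrite exprVn -s2 divff // expf_neq0.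
have odd_p : odd p by case: (even_prime p_pr) p_gt3 => [->|].
have [a [b ab]] : exists a b : 'F_p, (a ^+ 2 + b ^+ 2 = -1)%R.
  by apply: finField_sum2sqr; rewrite card_Fp.
have nz2 : (2 != 0 :> 'F_p)%R by rewrite Fp_natr_eq0 // gtnNdvd // ltnW.
have [_ iE] := SL2_mem (det_qi ab).
have [_ jE] := SL2_mem (det_qj ab).
have [_ zE] := SL2_mem (det_qz ab r3).
have k_ge3 : 3 <= k by apply: leq_trans k_ge5.
split=> //.
- apply: congruent_pm1_dvdn; last exact: prime_gt0.
  have := quat_map_congruence p_pr p_gt3 ab r3 k_prime U0 jE zE.
  (* Both p - 1 and p + 1 are even, so divisibility by the odd [k] extends to 2 k. *)
  have co2k : coprime 2 k by rewrite coprime2n.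
  rewrite !Gauss_dvd // => /orP[] ->; rewrite !andbT dvdn2; apply/orP; [left | right].
    by rewrite -subn1 oddB ?prime_gt0 // odd_p.
  by rewrite dvdn2 oddS odd_p.
- apply: congruent_pm1_dvdn; last exact: prime_gt0.
  by apply/orP; apply: (Fp_sqrt3_mod12 p_pr p_gt3 s2).
exists (quat_map p_pr p_gt3 ab r3 k_prime k_ge3 U0 iE jE zE).
exact: quat_map_spec.
Qed.
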